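(* For all integers $m$ and $k$ with $1\le k\le m+1$, $$\sum_{i=k-1}^m\frac{(-1)^{m+i}\,i!\,(i+1)!\,s(m,i)}{(i-k+1)!} =m!\,\Biggl\{\lim_{t\to1}\frac{\mathrm{d}^k}{\mathrm{d} t^k}\biggl[\frac{e^{m/t}}{(e^{1/t}-1)^{m+1}}\biggr] +\int_1^\infty\frac1{[\ln(u-1)]^2+\pi^2}\, \lim_{t\to1}\frac{\mathrm{d}^k}{\mathrm{d} t^k}\biggl[\frac{e^{m/t}} {(e^{1/t}-1+u)^{m+1}}\biggr]\mathrm{d} u\Biggr\}.$$
   Context: The (signed) Stirling numbers of the first kind $s(n,k)$ are defined by $\prod_{k=0}^{n-1}(x-k)=\sum_{k=0}^n s(n,k)x^k$, or equivalently by $\frac{[\ln(1+x)]^m}{m!}=\sum_{k=m}^\infty\frac{s(k,m)}{k!}x^k$ for $|x|<1$. The variable $t$ is real and positive. *)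

(* Defs.v *)
From mathcomp Require Import all_boot all_order all_algebra.
From mathcomp Require Import all_classical all_reals all_analysis.

Set Implicit Arguments.
Unset Strict Implicit.
Unset Printing Implicit Defensive.

Import Order.TTheory GRing.Theory Num.Theory.
Import numFieldNormedType.Exports.

Local Open Scope classical_set_scope.
Local Open Scope ring_scope.

Definition stirling1 (n k : nat) : int :=
  (\prod_(j < n) ('X - (j%:Z)%:P) : {poly int})`_k.

Definition deriv_lim (R : realType) (k : nat) (f : R -> R) (a : R) : R :=
  lim (derive1n k f t @[t --> a^']).

(* [derive1n] and [lim] are total functions; this says that the value
   [deriv_lim k f a] is a genuine limit of genuine k-th derivatives. *)
Definition deriv_lim_exists (R : realType) (k : nat) (f : R -> R) (a : R)
    : Prop :=
  (\forall t \near a^', forall j : nat, (j < k)%N -> derivable (derive1n j f) t 1) /\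
  cvg (derive1n k f t @[t --> a^']).

(* Main.v *)
Require Import Defs.
From mathcomp Require Import all_boot all_order all_algebra.
From mathcomp Require Import all_classical all_reals all_analysis.
From mathcomp Require Import measurable_realfun ring lra.
Import Order.TTheory GRing.Theory Num.Theory.
Import numFieldNormedType.Exports.
Local Open Scope classical_set_scope.
Local Open Scope ring_scope.

(** Write [w(u) = 1 / (ln(u - 1)^2 + pi^2)] and [E = e^(1/t)].  The theorem is
    the [k]-th derivative at [t = 1] of
      [sum_i (-1)^(m+i) i! s(m,i) t^(i+1)
         = m! (E^m / (E - 1)^(m+1) + int_1^oo w(u) E^m / (E - 1 + u)^(m+1) du)],
    which follows by induction on [m] from the case [m = 0]: with [A_m] the left
    hand side, both sides satisfy [A_(m+1) = t^2 A_m' + m A_m], by the recurrence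
    of the Stirling numbers and by differentiation under the integral sign.

    The case [m = 0] is [1 / ln X = 1 / (X - 1) + int_1^oo w(u) / (X - 1 + u) du]
    at [X = E].  Substituting [u = 1 + e^s] and writing [w] as an integral of
    [sin(pi c) e^(- c s)] over [0 < c < 1], Tonelli's theorem reduces it to
    [B(c) = pi / sin(pi c)] where [B(c) = int_R e^(cs) / (1 + e^s) ds].  For this,
    Tonelli's theorem gives [B(c)^2 = int_R e^(cr) r / (e^r - 1) dr], whence
    [B(c/2)^2 + B((c+1)/2)^2 = 4 B(c)^2].  The square of [pi / sin(pi c)] satisfies
    the same equation, and this equation contracts differences bounded by a
    multiple of [1/c + 1/(1-c)], so the two squares agree. *)

Set Implicit Arguments.
Unset Strict Implicit.

(** * Rules of differentiation on the real line *)

Section derivatives.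
Context {R : realType}.
Implicit Types (f g : R -> R) (x a b : R).

Lemma der_cst (c x : R) : is_derive x 1 (fun=> c) 0.
Proof. exact: is_derive_cst. Qed.

Lemma der_id x : is_derive x 1 (fun y => y) 1.
Proof. exact: is_derive_id. Qed.

Lemma der_add f g x a b : is_derive x 1 f a -> is_derive x 1 g b ->
  is_derive x 1 (fun y => f y + g y) (a + b).
Proof. exact: is_deriveD. Qed.

Lemma der_opp f x a : is_derive x 1 f a -> is_derive x 1 (fun y => - f y) (- a).
Proof. exact: is_deriveN. Qed.

Lemma der_mul f g x a b : is_derive x 1 f a -> is_derive x 1 g b ->
  is_derive x 1 (fun y => f y * g y) (a * g x + f x * b).
Proof.
move=> fa gb; apply: (is_derive_eq (is_deriveM fa gb)).
by rewrite /GRing.scale/= addrC [g x * _]mulrC.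
Qed.

Lemma der_exprn f n x a : is_derive x 1 f a ->
  is_derive x 1 (fun y => f y ^+ n) (n%:R * f x ^+ n.-1 * a).
Proof.
move=> fa; elim: n => [|n ih]; first by rewrite !mul0r; exact: der_cst.
under eq_fun do rewrite exprS.
apply: (is_derive_eq (der_mul fa ih)).
case: n {ih} => [|n]; first by rewrite /= expr0; ring.
by rewrite /= !exprS -[n.+2%:R]natr1; ring.
Qed.

Lemma der_inv f x a : f x != 0 -> is_derive x 1 f a ->
  is_derive x 1 (fun y => (f y)^-1) (- (a / f x ^+ 2)).
Proof.
move=> fx0 fa; apply: (is_derive_eq (is_deriveV fx0 fa)).
by rewrite /GRing.scale/= mulNr mulrC.
Qed.

Lemma der_expR f x a : is_derive x 1 f a ->
  is_derive x 1 (fun y => expR (f y)) (expR (f x) * a).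
Proof. by move=> fa; apply: is_derive1_comp. Qed.

Lemma der_sin f x a : is_derive x 1 f a ->
  is_derive x 1 (fun y => sin (f y)) (cos (f x) * a).
Proof. by move=> fa; apply: is_derive1_comp. Qed.

Lemma der_cos f x a : is_derive x 1 f a ->
  is_derive x 1 (fun y => cos (f y)) (- sin (f x) * a).
Proof. by move=> fa; apply: is_derive1_comp. Qed.

Lemma der_ln f x a : 0 < f x -> is_derive x 1 f a ->
  is_derive x 1 (fun y => ln (f y)) ((f x)^-1 * a).
Proof.
by move=> fx0 fa; apply: is_derive1_comp; exact: is_derive1_ln.
Qed.

Lemma der_atan f x a : is_derive x 1 f a ->
  is_derive x 1 (fun y => atan (f y)) ((1 + f x ^+ 2)^-1 * a).
Proof. by move=> fa; apply: is_derive1_comp. Qed.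

Lemma der_continuous f (d : R -> R) :
  (forall x, is_derive x 1 f (d x)) -> continuous f.
Proof. by move=> df x; apply/differentiable_continuous/derivable1_diffP. Qed.

End derivatives.

(* The instances of [is_derive] do not apply to every function given in
   eta-expanded form, and instance resolution picks wrong decompositions; the
   syntax-directed rules above avoid both problems. *)
Ltac der_rules := repeat first
  [ eassumption
  | notypeclasses refine (der_cst _ _) | notypeclasses refine (der_id _)
  | notypeclasses refine (der_add _ _) | notypeclasses refine (der_opp _)
  | notypeclasses refine (der_mul _ _) | notypeclasses refine (der_exprn _ _)
  | notypeclasses refine (der_inv _ _) | notypeclasses refine (der_expR _)
  | notypeclasses refine (der_sin _) | notypeclasses refine (der_cos _)
  | notypeclasses refine (der_ln _ _) | notypeclasses refine (der_atan _) ].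

Ltac der := notypeclasses refine (is_derive_eq _ _); [der_rules|lazy beta].

(** * Integration over the real line: affine and exponential substitutions, antiderivatives *)

Section calculus.
Context {R : realType}.
Local Notation mu := (@lebesgue_measure R).

Lemma measurable_invr : measurable_fun [set: R] (@GRing.inv R).
Proof.
have -> : [set: R] = `]-oo, 0[ `|` [set 0] `|` `]0, +oo[ :> set R.
  apply/seteqP; split => x //= _; rewrite !in_itv/= !andbT.
  by case: (ltgtP x 0) => [||->]; [left; left|right|left; right].
apply/measurable_funU; [exact: measurableU| exact: measurable_itv|split].
- apply/measurable_funU => //; split; last exact: measurable_fun_set1.
  apply: open_continuous_measurable_fun => // x; rewrite inE/= in_itv/= => x0.
  by apply: inv_continuous; rewrite lt_eqF.
- apply: open_continuous_measurable_fun => // x.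
  rewrite inE/= in_itv/= andbT => x0.
  by apply: inv_continuous; rewrite gt_eqF.
Qed.

Lemma measurable_funV d (T : measurableType d) (f : T -> R) :
  measurable_fun setT f -> measurable_fun setT (fun x => (f x)^-1).
Proof. by move=> mf; apply: (measurableT_comp measurable_invr mf). Qed.

Lemma measurable_affine (a b : R) :
  measurable_fun [set: R] (fun x : R => a * x + b).
Proof. by apply: measurable_funD => //; exact: mulrl_measurable. Qed.

(** The image of Lebesgue measure under [x -> a x + b], scaled by [a], gives each half-open interval
    its length, so by uniqueness it is Lebesgue measure. *)
Lemma ge0_integral_affine (f : R -> \bar R) (a b : R) : 0 < a ->
  measurable_fun [set: R] f -> (forall x, (0 <= f x)%E) ->
  (\int[mu]_x f x = a%:E * \int[mu]_x f (a * x + b)%R)%E.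
Proof.
move=> a0 mf f0.
pose aff := (fun x : R => a * x + b) : measurableTypeR R -> measurableTypeR R.
have mphi : measurable_fun setT aff by exact: measurable_affine.
have -> : (\int[mu]_x f (a * x + b)%R = \int[pushforward mu aff]_x f x)%E.
  by rewrite (@ge0_integral_pushforward _ _ _ _ R aff mphi mu setT f).
rewrite -(@ge0_integral_mscale _ _ _ (pushforward mu aff) setT measurableT
  (NngNum (ltW a0)) f)//.
apply: eq_measure_integral => //= A mA _.
apply: (@lebesgue_measure_unique R
  (mscale (NngNum (ltW a0)) (pushforward mu aff)) _ A mA) => _ [[x y] _ <-].
rewrite /= /mscale/= /pushforward.
have -> : aff @^-1` `]x, y] = `](x - b) / a, (y - b) / a]%classic.
  apply/seteqP; split => z /=; rewrite !in_itv/= /aff;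
    by rewrite ltr_pdivrMr// ler_pdivlMr// (mulrC z) ltrBlDr lerBrDr.
rewrite !lebesgue_measure_itv/= !lte_fin ltr_pM2r ?invr_gt0// ltrD2r.
case: ifPn => _; last by rewrite mule0.
by rewrite -EFinD -EFinM; congr EFin; field; rewrite gt_eqF.
Qed.


Lemma itvNn_bigcup : \bigcup_n `[- n.+1%:R, n.+1%:R]%classic = [set: R].
Proof.
apply/seteqP; split => x //= _.
exists (Num.truncn `|x|) => //=; rewrite in_itv/= -ler_norml.
by rewrite ltW// truncnS_gt.
Qed.

(** Monotone convergence along the intervals [[- n.+1, n.+1]], on each of which the fundamental
    theorem of calculus applies. *)
Lemma ge0_integralT_FTC (f F : R -> R) (l l' : R) :
  (forall x, 0 <= f x) -> continuous f ->
  (forall x : R, is_derive x 1 F (f x)) ->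
  F x @[x --> +oo] --> l -> F x @[x --> -oo] --> l' ->
  (\int[mu]_x (f x)%:E = (l - l')%:E)%E.
Proof.
move=> f0 cf dF Fl Fl'.
pose A (n : nat) : set R := `[- n.+1%:R, n.+1%:R]%classic.
have ndA : nondecreasing_seq A.
  move=> m n mn; apply/subsetPset => x; rewrite /A/= !in_itv/= -!ler_norml.
  by move=> /le_trans; apply; rewrite ler_nat ltnS.
have := @ge0_nondecreasing_set_cvg_integral _ (measurableTypeR R) R A
  (EFin \o f) mu ndA (fun=> measurable_itv _).
rewrite /A itvNn_bigcup => /(_ _ _)/cvg_unique; apply => //.
- move=> i; apply: measurable_funTS; apply/measurable_EFinP.
  exact: continuous_measurable_fun.
- by move=> i x _; rewrite lee_fin.
have cF : continuous F.
  by move=> x; apply/differentiable_continuous/derivable1_diffP.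
rewrite (_ : (fun i : nat => _) =
    (fun i : nat => (F i.+1%:R - F (- i.+1%:R))%:E)); last first.
  apply/funext => i; rewrite EFinB; apply: continuous_FTC2 => //.
  - by rewrite gtrN.
  - exact: continuous_subspaceT.
  - split => //.
    + by apply: cvg_at_right_filter; exact: cF.
    + by apply: cvg_at_left_filter; exact: cF.
  - by move=> x _; rewrite derive1E; exact: derive_val.
apply: cvg_EFin; first exact: nearW.
have nyy : (i.+1%:R : R) @[i --> \oo] --> +oo.
  by rewrite (cvg_shiftS (fun n : nat => n%:R : R)); exact: cvgr_idn.
apply: cvgB; first exact: (cvg_comp _ _ nyy Fl).
by move/cvgNrNy : nyy => nyy; exact: (cvg_comp _ _ nyy Fl').
Qed.

Lemma expR_itv_bigcup :
  \bigcup_n `[1 + expR (- n.+1%:R), 1 + expR n.+1%:R]%classic =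
  `]1, +oo[%classic :> set R.
Proof.
apply/seteqP; split => [x [n _ /=]|x /=].
  rewrite !in_itv/= andbT => /andP[+ _]; apply: lt_le_trans.
  by rewrite ltrDl expR_gt0.
rewrite in_itv/= andbT => x1; exists (Num.truncn `|ln (x - 1)|) => //=.
have x0 : 0 < x - 1 by rewrite subr_gt0.
have xE : x = 1 + expR (ln (x - 1)) by rewrite lnK// addrC subrK.
have /ltW := truncnS_gt `|ln (x - 1)|; rewrite ler_norml => /andP[h1 h2].
rewrite in_itv/=; apply/andP; split.
  by rewrite [leRHS]xE lerD2l ler_expR.
by rewrite [leLHS]xE lerD2l ler_expR.
Qed.

(** Substitution on the compact intervals [[- n.+1, n.+1]], whose images under [1 + e^s] exhaust
    []1, +oo[], then monotone convergence on both sides. *)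
Lemma ge0_integral_oneDexpR (G : R -> R) :
  (forall u, 1 < u -> 0 <= G u) -> {in `]1, +oo[, continuous G} ->
  (\int[mu]_(u in `]1%R, +oo[) (G u)%:E =
   \int[mu]_s (G (1 + expR s) * expR s)%:E)%E.
Proof.
move=> G0 cG.
have e1 (s : R) : 1 < 1 + expR s by rewrite ltrDl expR_gt0.
pose A (n : nat) : set R := `[- n.+1%:R, n.+1%:R]%classic.
pose B (n : nat) : set R := `[1 + expR (- n.+1%:R), 1 + expR n.+1%:R]%classic.
have ndA : nondecreasing_seq A.
  move=> m n mn; apply/subsetPset => x; rewrite /A/= !in_itv/= -!ler_norml.
  by move=> /le_trans; apply; rewrite ler_nat ltnS.
have ndB : nondecreasing_seq B.
  move=> m n mn; apply/subsetPset; apply: subset_itv; rewrite bnd_simp.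
    by rewrite lerD2l ler_expR lerN2 ler_nat ltnS.
  by rewrite lerD2l ler_expR ler_nat ltnS.
have cGe : continuous (fun s => G (1 + expR s)).
  move=> s; apply: (@continuous_comp _ _ _ (fun s => 1 + expR s) G).
    by apply: cvgD; [exact: cvg_cst|exact: continuous_expR].
  by apply: cG; rewrite in_itv/= andbT.
have cGee : continuous (fun s => G (1 + expR s) * expR s).
  by move=> s; apply: cvgM; [exact: cGe|exact: continuous_expR].
have BS i : B i `<=` `]1, +oo[.
  move=> u; rewrite /B/= !in_itv/= andbT => /andP[+ _].
  exact: lt_le_trans.
have mG : measurable_fun (`]1, +oo[%classic : set R) G.
  apply: open_continuous_measurable_fun; first exact: interval_open.
  by move=> u; rewrite inE; exact: cG.
have := @ge0_nondecreasing_set_cvg_integral _ (measurableTypeR R) R A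
  (EFin \o (fun s => G (1 + expR s) * expR s)) mu ndA
  (fun=> measurable_itv _).
have := @ge0_nondecreasing_set_cvg_integral _ (measurableTypeR R) R B (EFin \o G) mu ndB
  (fun=> measurable_itv _).
rewrite /A /B itvNn_bigcup expR_itv_bigcup => /(_ _ _) cvB /(_ _ _) cvA.
apply: (cvg_unique _ (cvB _ _)) => //.
- move=> i; apply/measurable_EFinP.
  apply: (measurable_funS _ _ mG) => //.
  exact: BS.
- move=> i x; rewrite /= in_itv/= => /andP[+ _] => /(lt_le_trans (e1 _)) x1.
  by rewrite lee_fin G0.
rewrite (_ : (fun i : nat => _) = (fun i : nat =>
  \int[mu]_(s in `[(- i.+1%:R)%R, i.+1%:R]) (G (1 + expR s) * expR s)%:E)%E).
  apply: cvA.
  - move=> i; apply: measurable_funTS; apply/measurable_EFinP.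
    exact: continuous_measurable_fun.
  - by move=> i x _; rewrite lee_fin mulr_ge0// ?expR_ge0// G0.
have dE (x : R) : is_derive x 1 (fun s : R => 1 + expR s) (expR x).
  by der; rewrite add0r mulr1.
have dEE : derive1 (fun s : R => 1 + expR s) = expR.
  by apply/funext => x; rewrite derive1E; apply: derive_val.
apply/funext => i.
rewrite (@integration_by_substitution_increasing _ (fun s : R => 1 + expR s)).
- by apply: eq_integral => x _; rewrite /= dEE.
- by rewrite (@le_trans _ _ 0)// oppr_le0.
- by move=> x y _ _; rewrite ltrD2l ltr_expR.
- by rewrite dEE => x _; exact: continuous_expR.
- rewrite dEE; apply/cvg_ex; exists (expR (- i.+1%:R)).
  by apply: cvg_at_right_filter; exact: continuous_expR.
- rewrite dEE; apply/cvg_ex; exists (expR (i.+1%:R)).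
  by apply: cvg_at_left_filter; exact: continuous_expR.
- split => //.
  + apply: cvg_at_right_filter.
    by apply: cvgD; [exact: cvg_cst|exact: continuous_expR].
  + apply: cvg_at_left_filter.
    by apply: cvgD; [exact: cvg_cst|exact: continuous_expR].
- by apply: continuous_in_subspaceT => u; rewrite inE => /BS u1; exact: cG.
Qed.

End calculus.

(** * The integral of [e^(cs) / (1 + e^s)] *)

Section betaR.
Context {R : realType}.
Local Notation mu := (@lebesgue_measure R).

Lemma measurable_expRM (c : R) : measurable_fun [set: R] (fun s : R => expR (c * s)).
Proof. by apply: measurableT_comp => //; exact: mulrl_measurable. Qed.

Lemma continuous_expRM (c : R) : continuous (fun s : R => expR (c * s)).
Proof.
move=> x; apply: continuous_comp; last exact: continuous_expR.
by apply: cvgM; [exact: cvg_cst|exact: cvg_id].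
Qed.

Lemma cvgNyr_expR : @expR R x @[x --> -oo] --> 0.
Proof.
apply/cvgNy_compNP; exact: cvgr_expR.
Qed.

Lemma cvgyr_expRNM (a : R) : 0 < a -> expR (- a * x) @[x --> +oo] --> (0 : R).
Proof.
move=> a0.
rewrite (_ : (fun x => _) = (fun z => expR (- z)) \o (fun z : R => a * z)).
  apply: (@cvg_comp _ _ _ _ _ _ (pinfty_nbhs R)); last exact: cvgr_expR.
  exact: gt0_cvgMry.
by apply/funext => x /=; rewrite mulNr.
Qed.

Lemma integral0y_expRNM (a : R) : 0 < a ->
  (\int[mu]_(x in `[0%R, +oo[) (expR (- a * x))%:E = a^-1%:E)%E.
Proof.
move=> a0.
have d (x : R) : is_derive x 1 (fun x => - (a^-1 * expR (- a * x))) (expR (- a * x)).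
  der.
  by field; rewrite gt_eqF.
have cF : continuous (fun x => - (a^-1 * expR (- a * x))).
  by move=> x; apply/differentiable_continuous/derivable1_diffP.
rewrite (@ge0_continuous_FTC2y _ _ (fun x => - (a^-1 * expR (- a * x))) _ 0).
- by rewrite mulr0 expR0 mulr1 EFinN oppeK add0e.
- by move=> x _; exact: expR_ge0.
- by apply: continuous_subspaceT; exact: continuous_expRM.
- rewrite -[X in _ --> X]oppr0 -[in X in _ --> X](mulr0 a^-1); apply: cvgN.
  by apply: cvgM; [exact: cvg_cst|exact: cvgyr_expRNM].
- by move=> x _.
- by apply: cvg_at_right_filter; exact: cF.
- by move=> x _; rewrite derive1E; exact: derive_val.
Qed.

(** In the variable [x = e^s] its integral becomes that of [x^(c-1) / (1 + x)], the beta integral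
    [B(c, 1 - c)]. *)
Definition beta_kernel (c s : R) : R := expR (c * s) / (1 + expR s).

Lemma oneDexpR_gt0 (s : R) : 0 < 1 + expR s.
Proof. by rewrite addr_gt0// expR_gt0. Qed.

Lemma beta_kernel_gt0 (c s : R) : 0 < beta_kernel c s.
Proof. by rewrite divr_gt0// ?expR_gt0// oneDexpR_gt0. Qed.

Lemma continuous_beta_kernel (c : R) : continuous (beta_kernel c).
Proof.
move=> x; apply: cvgM; first exact: continuous_expRM.
apply: cvgV; first by rewrite gt_eqF// oneDexpR_gt0.
by apply: cvgD; [exact: cvg_cst|exact: continuous_expR].
Qed.

Lemma measurable_beta_kernel (c : R) : measurable_fun [set: R] (beta_kernel c).
Proof. by apply: continuous_measurable_fun; exact: continuous_beta_kernel. Qed.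

Lemma beta_kernelN (c s : R) : beta_kernel (1 - c) s = beta_kernel c (- s).
Proof.
rewrite /beta_kernel mulrBl mul1r expRD mulrN !expRN.
have := expR_gt0 s; have := expR_gt0 (c * s) => ? ?.
by field; apply/and3P; split; rewrite gt_eqF// ?addr_gt0.
Qed.

(** The part of the beta integral over [s <= 0], reflected. At [1 - c] it gives the part over
    [s >= 0], so one pair of bounds serves both ends. *)
Definition half_beta (c : R) : \bar R :=
  (\int[mu]_(s in `[0%R, +oo[) (beta_kernel c (- s))%:E)%E.

Lemma continuous_beta_kernelN (c : R) : continuous (fun s => beta_kernel c (- s)).
Proof.
move=> x; apply: (@continuous_comp _ _ _ (fun s : R => - s) (beta_kernel c)).
  exact: continuousN.
exact: continuous_beta_kernel.
Qed.

Lemma half_beta_le (c : R) : 0 < c -> (half_beta c <= c^-1%:E)%E.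
Proof.
move=> c0; rewrite -(integral0y_expRNM c0); apply: ge0_le_integral => //.
- by move=> x _; rewrite lee_fin ltW// beta_kernel_gt0.
- apply/measurable_EFinP; apply: measurable_funTS.
  by apply: continuous_measurable_fun; exact: continuous_beta_kernelN.
- by apply/measurable_EFinP; apply: measurable_funTS; exact: measurable_expRM.
- move=> x _; rewrite lee_fin /beta_kernel mulrN -mulNr ler_pdivrMr ?oneDexpR_gt0//.
  by rewrite ler_peMr ?expR_ge0// lerDl expR_ge0.
Qed.

(** From [1 / (1 + q) >= 1 - q] with [q = e^(-s)]; the correction integrates to [1 / (1 + c)], which
    stays bounded as [c] tends to [0]. *)
Lemma half_beta_ge (c : R) : 0 < c -> (c^-1%:E <= half_beta c + (1 + c)^-1%:E)%E.
Proof.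
move=> c0; have c10 : 0 < 1 + c by rewrite addr_gt0.
rewrite -(integral0y_expRNM c0) -(integral0y_expRNM c10).
have mk : measurable_fun (`[0, +oo[%classic : set R) (fun s => (beta_kernel c (- s))%:E).
  apply/measurable_EFinP; apply: measurable_funTS.
  by apply: continuous_measurable_fun; exact: continuous_beta_kernelN.
have me a : measurable_fun (`[0, +oo[%classic : set R) (fun s => (expR (- a * s))%:E).
  by apply/measurable_EFinP; apply: measurable_funTS; exact: measurable_expRM.
rewrite /half_beta -ge0_integralD//; first last.
- exact: me.
- by move=> x _; rewrite lee_fin ltW// beta_kernel_gt0.
apply: ge0_le_integral => //.
- exact: me.
- by apply: emeasurable_funD; [exact: mk|exact: me].
move=> x; rewrite /= in_itv/= andbT => x0; rewrite -EFinD lee_fin.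
have e0 := oneDexpR_gt0 (- x).
rewrite /beta_kernel mulrN -mulNr (_ : - (1 + c) * x = - x + - c * x); last by ring.
rewrite expRD; have p0 := expR_gt0 (- c * x); have q0 := expR_gt0 (- x).
rewrite -lerBlDr ler_pdivlMr//.
set p := expR (- c * x) in p0 *; set q := expR (- x) in q0 *.
have := mulr_gt0 p0 (mulr_gt0 q0 q0); nra.
Qed.

Lemma integral_beta_kernel_half (c : R) :
  (\int[mu]_s (beta_kernel c s)%:E = half_beta c + half_beta (1 - c))%E.
Proof.
have mk : measurable_fun [set: R] (fun s => (beta_kernel c s)%:E).
  by apply/measurable_EFinP; exact: measurable_beta_kernel.
have -> : [set: R] = `]-oo, 0%R] `|` `]0%R, +oo[ :> set R.
  by rewrite -setCitvl setUv.
rewrite ge0_integral_setU//=; last first.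
- by rewrite -setCitvl; apply/disj_setPCl.
- by move=> x _; rewrite lee_fin ltW// beta_kernel_gt0.
- exact: measurable_funTS.
congr (_ + _)%E.
  rewrite -[X in `]-oo, X]]oppr0 ge0_integration_by_substitutionNy//.
    exact/continuous_subspaceT/continuous_beta_kernel.
  by move=> x _; rewrite ltW// beta_kernel_gt0.
rewrite integral_itv_obnd_cbnd; last exact: measurable_funTS.
by apply: eq_integral => x _; rewrite beta_kernelN opprK.
Qed.

Definition betaR (c : R) : R := fine (\int[mu]_s (beta_kernel c s)%:E)%E.
(** These are the polar parts of [pi / sin (pi c)] at [c = 0] and [c = 1]; the beta integral has the
    same ones. *)
Definition pole_sum (c : R) : R := c^-1 + (1 - c)^-1.

Lemma integral_beta_kernel (c : R) : 0 < c < 1 ->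
  (\int[mu]_s (beta_kernel c s)%:E = (betaR c)%:E)%E.
Proof.
move=> /andP[c0 c1]; have d0 : 0 < 1 - c by rewrite subr_gt0.
rewrite /betaR fineK// ge0_fin_numE; last first.
  by apply: integral_ge0 => x _; rewrite lee_fin ltW// beta_kernel_gt0.
rewrite integral_beta_kernel_half.
apply: (@le_lt_trans _ _ (c^-1%:E + (1 - c)^-1%:E)%E); last by rewrite -EFinD ltry.
by apply: leeD; exact: half_beta_le.
Qed.

(** The two halves fall short of their poles by at most [1 / (1 + c)] and [1 / (1 + (1 - c))], each
    at most [1]. *)
Lemma betaR_pole_sum (c : R) : 0 < c < 1 -> `|betaR c - pole_sum c| <= 2.
Proof.
move=> /[dup] c01 /andP[c0 c1]; have d0 : 0 < 1 - c by rewrite subr_gt0.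
have u : betaR c <= pole_sum c.
  rewrite -lee_fin -integral_beta_kernel// integral_beta_kernel_half EFinD.
  by apply: leeD; exact: half_beta_le.
have l : pole_sum c <= betaR c + 2.
  rewrite -lee_fin [leRHS]EFinD -integral_beta_kernel// integral_beta_kernel_half /pole_sum.
  have h1 := half_beta_ge c0; have h2 := half_beta_ge d0.
  rewrite EFinD; apply: (le_trans (leeD h1 h2)).
  rewrite addeACA; apply: leeD => //; rewrite -EFinD lee_fin.
  have i1 : (1 + c)^-1 <= 1 by rewrite invf_le1 ?lerDl ?ltW// addr_gt0.
  have i2 : (1 + (1 - c))^-1 <= 1 by rewrite invf_le1 ?lerDl ?ltW// addr_gt0.
  by rewrite (_ : 2 = 1 + 1)//; exact: lerD.
by rewrite ler_norml; lra.
Qed.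

Lemma betaR_ge0 (c : R) : 0 <= betaR c.
Proof.
by rewrite fine_ge0// integral_ge0// => x _; rewrite lee_fin ltW// beta_kernel_gt0.
Qed.

End betaR.

(** * The square of the beta integral and its duplication equation *)

Section betaR_square.
Context {R : realType}.
Local Notation mu := (@lebesgue_measure R).

(* [kappa 0] is [0], not the limit [1]: harmless, as [{0}] is a null set. *)
Definition kappa (r : R) : R := r / (expR r - 1).

Lemma kappa_ge0 r : 0 <= kappa r.
Proof.
rewrite /kappa; have [r0|r0] := leP 0 r.
  by rewrite divr_ge0// subr_ge0 -expR0 ler_expR.
rewrite -mulrNN -invrN opprB divr_ge0// ?oppr_ge0 ?subr_ge0 ?(ltW r0)//.
by rewrite -expR0 ler_expR ltW.
Qed.

Lemma measurable_kappa : measurable_fun [set: R] kappa.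
Proof.
apply: measurable_funM => //; apply: measurable_funV.
by apply: measurable_funB.
Qed.

(** From [e^r - 1 = (e^(r/2) - 1) (e^(r/2) + 1)]; this is the source of the duplication equation. *)
Lemma kappa_half (r : R) : kappa r * (1 + expR (r / 2)) = 2 * kappa (r / 2).
Proof.
rewrite /kappa; have [->|r0] := eqVneq r 0; first by rewrite !mul0r mulr0.
have e1 : expR (r / 2) - 1 != 0.
  by rewrite subr_eq0 -expR0 (inj_eq (@expR_inj _)) mulf_neq0.
have eE : expR r = expR (r / 2) ^+ 2 by rewrite -expRM_natr; congr expR; field.
have e0 := expR_gt0 (r / 2); rewrite eE.
set q := expR (r / 2) in e1 e0 *.
have e2 : q ^+ 2 - 1 != 0.
  by rewrite -[1](expr1n _ 2) subr_sqr mulf_neq0// gt_eqF// addr_gt0.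
by field; apply/andP.
Qed.

Definition softplus (s : R) : R := ln (1 + expR s).

Lemma softplusN s : softplus s = s + softplus (- s).
Proof.
rewrite /softplus -[X in _ = X + _]expRK -lnM ?posrE ?expR_gt0 ?oneDexpR_gt0//.
by congr ln; rewrite mulrDr mulr1 -expRD subrr expR0 addrC.
Qed.

Lemma softplus_cvgNy : softplus x @[x --> -oo] --> 0.
Proof.
have h : 1 + expR x @[x --> -oo] --> (1 + 0 : R).
  by apply: cvgD; [exact: cvg_cst|exact: cvgNyr_expR].
rewrite addr0 in h; rewrite -ln1.
by apply: (cvg_comp _ _ h); exact: continuous_ln.
Qed.

Lemma softplusN_cvgy : softplus (- x) @[x --> +oo] --> 0.
Proof. by apply/(@cvgNy_compNP _ _ softplus); exact: softplus_cvgNy. Qed.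

Lemma cvgNy_sub (f : R -> R) (r l : R) :
  f x @[x --> -oo] --> l -> f (x - r) @[x --> -oo] --> l.
Proof.
move=> fl; apply: (@cvg_comp _ _ _ (fun x : R => x - r) f _ (ninfty_nbhs R)) => //.
apply/cvgrNyPle => A; near=> x; rewrite lerBlDr.
by near: x; apply: nbhs_ninfty_le; rewrite num_real.
Unshelve. all: by end_near. Qed.

(** Partial fractions in [e^s] give the antiderivative [F]. At [+oo] the linear parts of the two
    [softplus] terms differ by [r]; at [-oo] both terms vanish. *)
Lemma integral_logistic_conv (r : R) : r != 0 ->
  (\int[mu]_s ((1 + expR s)^-1 * (1 + expR (r - s))^-1)%:E = (kappa r)%:E)%E.
Proof.
move=> r0.
have e1 : expR r - 1 != 0 by rewrite subr_eq0 -expR0 (inj_eq (@expR_inj _)).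
pose F s := (softplus s - softplus (s - r)) / (expR r - 1).
rewrite -[kappa r]subr0; apply: (@ge0_integralT_FTC _ _ F).
- by move=> x; rewrite mulr_ge0// invr_ge0 ltW// oneDexpR_gt0.
- move=> x; apply: cvgM; apply: cvgV; rewrite ?gt_eqF ?oneDexpR_gt0//.
    by apply: cvgD; [exact: cvg_cst|exact: continuous_expR].
  apply: cvgD; [exact: cvg_cst|].
  apply: (@continuous_comp _ _ _ (fun s => r - s) expR); last exact: continuous_expR.
  by apply: cvgB; [exact: cvg_cst|exact: cvg_id].
- move=> x; rewrite /F /softplus.
  der; rewrite ?oneDexpR_gt0//.
  have a0 := expR_gt0 x; have b0 := expR_gt0 r.
  rewrite !expRB; set a := expR x in a0 *; set b := expR r in e1 b0 *.
  by field; rewrite e1 !gt_eqF ?addr_gt0.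
- rewrite /F /kappa; apply: cvgM; last exact: cvg_cst.
  rewrite (_ : (fun x => _) =
    (fun x => r + (softplus (- x) - softplus (- (x - r))))); last first.
    by apply/funext => x; rewrite (softplusN x) (softplusN (x - r)); ring.
  rewrite -[X in _ --> X]addr0; apply: cvgD; first exact: cvg_cst.
  rewrite -[X in _ --> X](subrr 0); apply: cvgB; first exact: softplusN_cvgy.
  rewrite (_ : (fun x => _) = (fun x => softplus ((- x) - - r))); last first.
    by apply/funext => x; rewrite opprB opprK addrC.
  apply/(@cvgNy_compNP _ _ (fun y => softplus (y - - r))).
  by apply: cvgNy_sub; exact: softplus_cvgNy.
- rewrite -(mul0r (expR r - 1)^-1); apply: cvgM; last exact: cvg_cst.
  rewrite -[X in _ --> X](subrr 0); apply: cvgB; first exact: softplus_cvgNy.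
  by apply: cvgNy_sub; exact: softplus_cvgNy.
Qed.

Lemma beta_kernelM (c s r : R) :
  beta_kernel c s * beta_kernel c (r - s) =
  expR (c * r) * ((1 + expR s)^-1 * (1 + expR (r - s))^-1).
Proof.
by rewrite /beta_kernel [in LHS]mulrACA -expRD -mulrDr [s + _]addrC subrK.
Qed.

(** The square is a double integral in [s] and [s']. With [r = s + s'] the exponentials combine to
    [e^(c r)], and Tonelli's theorem leaves the convolution computed in [integral_logistic_conv]. *)
Lemma betaR_sqr (c : R) : 0 < c < 1 ->
  ((betaR c ^+ 2)%:E = \int[mu]_r (expR (c * r) * kappa r)%:E)%E.
Proof.
move=> c01; have mk := @measurable_beta_kernel R c.
have k0 s : 0 <= beta_kernel c s by rewrite ltW// beta_kernel_gt0.
pose f (p : R * R) : \bar R := (beta_kernel c p.1 * beta_kernel c (p.2 - p.1))%:E.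
have mf : measurable_fun [set: R * R] f.
  apply/measurable_EFinP; apply: measurable_funM.
    by apply: measurableT_comp => //.
  apply: measurableT_comp => //.
  by apply: measurable_funB.
have f0 p : (0 <= f p)%E by rewrite lee_fin mulr_ge0.
transitivity (\int[mu]_s \int[mu]_r f (s, r))%E.
  rewrite expr2 EFinM -{1}integral_beta_kernel// -ge0_integralZr//; first last.
  - by rewrite lee_fin betaR_ge0.
  - by move=> x _; rewrite lee_fin.
  - exact/measurable_EFinP.
  apply: eq_integral => s _; rewrite -integral_beta_kernel//.
  rewrite (@ge0_integral_affine _ _ 1 (- s))//; first last.
  - exact/measurable_EFinP.
  rewrite mul1e -ge0_integralZl_EFin//; first last.
  - apply/measurable_EFinP; apply: measurableT_comp => //.
    exact: measurable_affine.
  - by move=> x _; rewrite lee_fin.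
  by apply: eq_integral => x _; rewrite mul1r.
rewrite fubini_tonelli//.
apply: ge0_ae_eq_integral => //.
- by apply: measurable_fun_fubini_tonelli_G.
- apply/measurable_EFinP; apply: measurable_funM; last exact: measurable_kappa.
  exact: measurable_expRM.
- by move=> r _; apply: integral_ge0 => s _; exact: f0.
- by move=> r _; rewrite lee_fin mulr_ge0 ?expR_ge0 ?kappa_ge0.
(* The inner integral is known for [r != 0] only, so the integrands are compared off the null set
   [{0}]. *)
exists [set 0]; split; [exact: measurable_set1|exact: lebesgue_measure_set1|].
move=> r /= /not_implyP[_ h]; apply: contrapT => r0; apply: h.
rewrite /f/=; under eq_integral do rewrite beta_kernelM EFinM.
rewrite ge0_integralZl_EFin ?expR_ge0//.
- by rewrite integral_logistic_conv ?EFinM//; exact/eqP.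
- apply/measurable_EFinP; apply: measurable_funM.
    by apply: measurable_funV; apply: measurable_funD.
  apply: measurable_funV; apply: measurable_funD => //.
  by apply: measurableT_comp => //; apply: measurable_funB.
Qed.

(** Halving the variable on the right produces [2 * kappa (r / 2)], which [kappa_half] splits into
    the two integrands on the left. *)
Lemma betaR_sqr_dup (c : R) : 0 < c < 1 ->
  betaR (c / 2) ^+ 2 + betaR ((c + 1) / 2) ^+ 2 = 4 * betaR c ^+ 2.
Proof.
move=> c01; have m (a : R) : measurable_fun [set: R] (fun r => (expR (a * r) * kappa r)%:E).
  apply/measurable_EFinP; apply: measurable_funM; last exact: measurable_kappa.
  exact: measurable_expRM.
have p (a r : R) : (0 <= (expR (a * r) * kappa r)%:E)%E.
  by rewrite lee_fin mulr_ge0 ?expR_ge0 ?kappa_ge0.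
apply: EFin_inj; rewrite EFinD [in RHS]EFinM !betaR_sqr; [|lra..].
rewrite -ge0_integralD//; [|exact: m..].
rewrite (@ge0_integral_affine _ (fun r => (expR (c * r) * kappa r)%:E) (2^-1) 0)//.
rewrite muleA -EFinM -ge0_integralZl_EFin//; last first.
  by apply: (measurableT_comp (m c)); exact: measurable_affine.
apply: eq_integral => r _; rewrite -EFinD -EFinM; congr EFin.
rewrite addr0 (mulrC 2^-1 r).
rewrite (_ : 4 / 2 * _ = expR (c * (r / 2)) * (2 * kappa (r / 2))); last by field.
rewrite -kappa_half (_ : (c + 1) / 2 * r = c * (r / 2) + r / 2); last by field.
rewrite (_ : c / 2 * r = c * (r / 2)); last by field.
by rewrite expRD; ring.
Qed.

End betaR_square.

(** * Identification of the beta integral with [pi / sin (pi c)] *)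

Section betaR_pi_csc.
Context {R : realType}.
Local Notation mu := (@lebesgue_measure R).
Implicit Types c x : R.

(** The difference of the two sides vanishes at [0] and has a nonnegative derivative; the next two
    bounds are obtained in the same way. *)
Lemma sin_lex x : 0 <= x -> sin x <= x.
Proof.
move=> x0; have d (y : R) : is_derive y 1 (fun y => y - sin y) (1 - cos y).
  by der; rewrite mulr1.
rewrite -subr_ge0; have <- : 0 - sin 0 = 0 :> R by rewrite sin0 subrr.
apply: (@ger0_derive1_ndecr _ (fun y => y - sin y) 0 x) => //.
- by move=> y _; rewrite derive1E (derive_val (is_derive := d y)) subr_ge0 cos_le1.
- by apply: continuous_subspaceT; exact: der_continuous d.
Qed.

Lemma cos_ge1Bx x : 0 <= x -> 1 - x <= cos x.
Proof.
move=> x0; have d (y : R) : is_derive y 1 (fun y => cos y + y) (- sin y + 1).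
  by der; rewrite mulr1.
rewrite lerBlDr; have <- : cos 0 + 0 = 1 :> R by rewrite cos0 addr0.
apply: (@ger0_derive1_ndecr _ (fun y => cos y + y) 0 x) => //.
- move=> y _; rewrite derive1E (derive_val (is_derive := d y)).
  by rewrite addrC subr_ge0 sin_le1.
- by apply: continuous_subspaceT; exact: der_continuous d.
Qed.

Lemma sin_ge x : 0 <= x -> x - x ^+ 2 / 2 <= sin x.
Proof.
move=> x0; have d (y : R) : is_derive y 1 (fun y => sin y - y + y ^+ 2 / 2) (cos y - 1 + y).
  by der; field.
rewrite -subr_ge0.
have <- : sin 0 - 0 + 0 ^+ 2 / 2 = 0 :> R.
  by rewrite sin0 subrr expr0n/= mul0r addr0.
rewrite opprB addrA (_ : sin x + _ - _ = sin x - x + x ^+ 2 / 2); last by ring.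
apply: (@ger0_derive1_ndecr _ (fun y => sin y - y + y ^+ 2 / 2) 0 x) => //.
- move=> y; rewrite in_itv/= => /andP[y0 _].
  rewrite derive1E (derive_val (is_derive := d y)).
  by have := cos_ge1Bx (ltW y0); lra.
- by apply: continuous_subspaceT; exact: der_continuous d.
Qed.

(** Up to [1] the bound [sin_ge] suffices; beyond, [sin x >= sin 1 >= 1/2], while [x / 4 <= 1/2]
    because [pi / 2 < 2]. *)
Lemma sin_ge_quarter x : 0 <= x <= pi / 2 -> x / 4 <= sin x.
Proof.
move=> /andP[x0 x1].
have [xle|xgt] := leP x 1.
  by apply: le_trans (sin_ge x0); nra.
have p2 : (pi : R) / 2 < 2 by exact: pihalf_lt2.
have s1 : sin 1 >= 1 / 2 :> R by have := @sin_ge 1 ler01; rewrite expr1n; lra.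
apply: (@le_trans _ _ (1 / 2)); first by lra.
apply: (le_trans s1); apply: ltW; rewrite ltr_sin// in_itv/=; have := @pi_ge2 R; lra.
Qed.

Definition pi_csc c : R := pi / sin (pi * c).

Lemma pi_itv c : 0 < c < 1 -> (0 : R) < pi * c < pi.
Proof.
move=> /andP[c0 c1]; rewrite mulr_gt0 ?pi_gt0//=.
by rewrite -[ltRHS]mulr1 ltr_pM2l// pi_gt0.
Qed.

Lemma pi_csc_gt0 c : 0 < c < 1 -> 0 < pi_csc c.
Proof. by move=> c01; rewrite divr_gt0 ?pi_gt0// sin_gt0_pi// pi_itv. Qed.

Lemma pi_csc_onem c : pi_csc (1 - c) = pi_csc c.
Proof.
by rewrite /pi_csc mulrBr mulr1 sinB cospi sinpi; congr (_ / _); ring.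
Qed.

(** Here [(1 - c)^-1] lies between [0] and [2], and [pi_csc c] between [c^-1] and [c^-1 + 16], so
    the difference lies between [-2] and [16]. *)
Lemma pi_csc_pole_sum_half c : 0 < c <= 1 / 2 -> `|pi_csc c - pole_sum c| <= 20.
Proof.
move=> /andP[c0 c1]; have p0 := @pi_gt0 R; have p2 := @pihalf_lt2 R.
have x0 : 0 < pi * c by rewrite mulr_gt0.
have xp : pi * c <= pi / 2.
  rewrite ler_pM2l//; lra.
have s0 : 0 < sin (pi * c).
  by apply: (lt_le_trans _ (@sin_ge_quarter _ _)); rewrite ?divr_gt0 ?(ltW x0).
have i1 : 0 < (1 - c)^-1 by rewrite invr_gt0; lra.
have i2 : (1 - c)^-1 <= 2.
  rewrite -[leRHS]invrK lef_pV2 ?posrE; lra.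
have e1 : c^-1 <= pi_csc c.
  rewrite /pi_csc ler_pdivlMr// ler_pdivrMl// [leRHS]mulrC; exact/sin_lex/ltW.
(* Cleared of denominators, this is [pi c <= (1 + 16 c) sin (pi c)]. The quadratic bound loses
   [(pi c)^2 / 2 <= 4 pi c^2], which [16 c sin (pi c) >= 4 pi c^2] makes up. *)
have e2 : pi_csc c <= c^-1 + 16.
  rewrite /pi_csc ler_pdivrMr//.
  have h1 := sin_ge (ltW x0).
  have h2 : pi * c / 4 <= sin (pi * c) by apply: sin_ge_quarter; rewrite ltW.
  rewrite -(ler_pM2l c0) [leRHS](_ : _ = (1 + 16 * c) * sin (pi * c)); last first.
    by field; rewrite gt_eqF.
  rewrite mulrC.
  have c2 : 0 <= 16 * c by lra.
  have := ler_wpM2l c2 h2.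
  have : (pi * c) ^+ 2 / 2 <= 4 * (pi * c * c).
    rewrite expr2; have := mulr_gt0 x0 c0; nra.
  nra.
rewrite /pole_sum ler_norml; lra.
Qed.

Lemma pi_csc_pole_sum c : 0 < c < 1 -> `|pi_csc c - pole_sum c| <= 20.
Proof.
move=> /andP[c0 c1]; have [h|h] := leP c (1 / 2).
  by apply: pi_csc_pole_sum_half; rewrite c0.
rewrite -pi_csc_onem (_ : pole_sum c = pole_sum (1 - c)); last first.
  by rewrite /pole_sum opprB addrCA subrr addr0 addrC.
by apply: pi_csc_pole_sum_half; lra.
Qed.

(** The angles on the left differ by [pi / 2]. With [s] and [k] the sine and cosine of [pi c / 2],
    use [1/s^2 + 1/k^2 = 1/(s k)^2] and [sin (pi c) = 2 s k]. *)
Lemma pi_csc_dup c : 0 < c < 1 ->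
  pi_csc (c / 2) ^+ 2 + pi_csc ((c + 1) / 2) ^+ 2 = 4 * pi_csc c ^+ 2.
Proof.
move=> c01; rewrite /pi_csc.
have h : 0 < c / 2 < 1 by lra.
have [s0 s1] : 0 < sin (pi * (c / 2)) /\ 0 < cos (pi * (c / 2)).
  split; first by rewrite sin_gt0_pi// pi_itv.
  rewrite cos_gt0_pihalf//; have p0 := @pi_gt0 R; apply/andP; split; nra.
rewrite (_ : pi * ((c + 1) / 2) = pi * (c / 2) + pi / 2); last by field.
rewrite sinDpihalf (_ : pi * c = pi * (c / 2) *+ 2); last by rewrite -mulr_natr; field.
rewrite sin_mulr2n.
have := cos2Dsin2 (pi * (c / 2)).
move: s0 s1; set s := sin _; set k := cos _ => s0 s1 e.
rewrite -mulr_natr.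
rewrite (_ : (pi / s) ^+ 2 + (pi / k) ^+ 2 =
    pi ^+ 2 * (k ^+ 2 + s ^+ 2) / (s * k) ^+ 2); last first.
  by field; rewrite !gt_eqF.
by rewrite e; field; rewrite !gt_eqF.
Qed.

(** The sum equals [1 / (c (1 - c))]. The bound lets constants be absorbed into multiples of
    [pole_sum]. *)
Lemma pole_sum_ge4 c : 0 < c < 1 -> 4 <= pole_sum c.
Proof.
move=> /andP[c0 c1]; have d0 : 0 < 1 - c by rewrite subr_gt0.
have -> : pole_sum c = (c * (1 - c))^-1 by rewrite /pole_sum; field; rewrite !gt_eqF.
rewrite -[leLHS]invrK lef_pV2 ?posrE ?mulr_gt0 ?invr_gt0//.
have := sqr_ge0 (c - 1 / 2); nra.
Qed.

(* The functional equation of [betaR_sqr_dup] divides by [4], so it contracts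
   multiples of [pole_sum] by [11 / 16]. *)
Lemma pole_sum_dup c : 0 < c < 1 ->
  pole_sum (c / 2) + pole_sum ((c + 1) / 2) <= 11 / 4 * pole_sum c.
Proof.
move=> /[dup] c01 /andP[c0 c1]; have d0 : 0 < 1 - c by rewrite subr_gt0.
have p4 := pole_sum_ge4 c01.
have a0 : 0 < 2 - c by lra.
have b0 : 0 < 1 + c by lra.
(* The last term is at most [6 / 2 = 3], hence at most [3/4] of [pole_sum c], and
   [2 + 3/4 = 11/4]. *)
have -> : pole_sum (c / 2) + pole_sum ((c + 1) / 2) =
    2 * pole_sum c + 6 * ((2 - c) * (1 + c))^-1.
  rewrite /pole_sum; field.
  rewrite !gt_eqF//; lra.
have : ((2 - c) * (1 + c))^-1 <= 2^-1.
  rewrite lef_pV2 ?posrE ?mulr_gt0//; nra.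
lra.
Qed.

(** For [n = 0] the difference of squares is at most [22 (2 pole_sum c + 22)], which
    [pole_sum c >= 4] brings below [200 pole_sum c]. Each use of the duplication equation multiplies
    the bound by [1/4 * 11/4 = 11/16]. *)
Lemma betaR_pi_csc_bound (n : nat) c : 0 < c < 1 ->
  `|betaR c ^+ 2 - pi_csc c ^+ 2| <= 200 * (11 / 16) ^+ n * pole_sum c.
Proof.
elim: n c => [|n ih] c c01.
  have h1 := betaR_pole_sum c01; have h2 := pi_csc_pole_sum c01; have p4 := pole_sum_ge4 c01.
  rewrite expr0 mulr1 subr_sqr normrM.
  have h3 : `|betaR c - pi_csc c| <= 22.
    rewrite (_ : betaR c - pi_csc c =
      (betaR c - pole_sum c) - (pi_csc c - pole_sum c)); last by ring.
    by apply: le_trans (ler_normB _ _) _; lra.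
  have h4 : `|betaR c + pi_csc c| <= 2 * pole_sum c + 22.
    rewrite (_ : betaR c + pi_csc c =
      (betaR c - pole_sum c) + (pi_csc c - pole_sum c) + 2 * pole_sum c); last by ring.
    apply: le_trans (ler_normD _ _) _; rewrite addrC lerD//.
      by rewrite ger0_norm//; lra.
    by apply: le_trans (ler_normD _ _) _; lra.
  apply: le_trans (ler_pM (normr_ge0 _) (normr_ge0 _) h3 h4) _; lra.
have c1 : 0 < c / 2 < 1 by lra.
have c2 : 0 < (c + 1) / 2 < 1 by lra.
have -> : betaR c ^+ 2 - pi_csc c ^+ 2 =
  4^-1 * ((betaR (c / 2) ^+ 2 - pi_csc (c / 2) ^+ 2) +
          (betaR ((c + 1) / 2) ^+ 2 - pi_csc ((c + 1) / 2) ^+ 2)).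
  have e1 := betaR_sqr_dup c01; have e2 := pi_csc_dup c01; lra.
rewrite normrM ger0_norm//.
have h := le_trans (ler_normD (betaR (c / 2) ^+ 2 - pi_csc (c / 2) ^+ 2) _)
  (lerD (ih _ c1) (ih _ c2)).
have q0 : 0 <= (11 / 16) ^+ n :> R by rewrite exprn_ge0//; lra.
have := pole_sum_dup c01; rewrite [_ ^+ n.+1]exprS.
move: h q0; set q := (11 / 16) ^+ n => h q0 h'.
have := ler_wpM2l q0 h'.
lra.
Qed.

Lemma betaR_pi_csc c : 0 < c < 1 -> betaR c = pi_csc c.
Proof.
move=> c01.
have : betaR c ^+ 2 - pi_csc c ^+ 2 = 0.
  apply/normr0_eq0/eqP; rewrite -[_ == _]orbF -/(_ || false).
  rewrite eq_le normr_ge0 andbT orbF.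
  have : (fun n => 200 * (11 / 16) ^+ n * pole_sum c) @ \oo --> 200 * 0 * pole_sum c.
    apply: cvgM; last exact: cvg_cst.
    apply: cvgM; first exact: cvg_cst.
    by apply: cvg_expr; rewrite ger0_norm; lra.
  rewrite mulr0 mul0r => cv.
  apply: (cvgr_to_ge cv).
  by near=> n; exact: betaR_pi_csc_bound.
move/eqP; rewrite subr_eq0 eqrXn2 ?betaR_ge0 ?ltW ?pi_csc_gt0//.
by move/eqP.
Unshelve. all: by end_near. Qed.

End betaR_pi_csc.

(** * The integral representation of [1 / ln] *)

Section kernel.
Context {R : realType}.
Local Notation mu := (@lebesgue_measure R).

Lemma sqrDpi_gt0 (s : R) : 0 < s ^+ 2 + pi ^+ 2.
Proof. by rewrite ltr_wpDl ?sqr_ge0// exprn_gt0// pi_gt0. Qed.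

Lemma integral_indic_oo (a b : R) (f : R -> R) :
  (\int[mu]_x (f x * \1_(`]a, b[%classic : set R) x)%:E =
   \int[mu]_(x in `]a, b[) (f x)%:E)%E.
Proof.
rewrite [RHS]integral_mkcond; apply: eq_integral => x _.
by rewrite patchE indicE; case: ifPn => _; rewrite ?mulr1 ?mulr0.
Qed.

(** Integrating by parts twice yields [F]. The identity expresses [1 / (s^2 + pi^2)] through
    exponentials in [s], which the beta integral can treat. *)
Lemma integral_sin_expR (s : R) :
  (\int[mu]_(c in `]0%R, 1%R[) (sin (pi * c) / pi * expR ((1 - c) * s))%:E =
   ((1 + expR s) / (s ^+ 2 + pi ^+ 2))%:E)%E.
Proof.
have p0 : (0 : R) < pi := @pi_gt0 R.
have q0 := sqrDpi_gt0 s.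
pose F (c : R) := - (expR ((1 - c) * s) * (s * sin (pi * c) + pi * cos (pi * c)))
  / ((s ^+ 2 + pi ^+ 2) * pi).
pose f (c : R) := sin (pi * c) / pi * expR ((1 - c) * s).
have dF (c : R) : is_derive c 1 F (f c).
  rewrite /F; der; rewrite /f.
  move: p0 q0; generalize (@pi R) => p p0 q0.
  by field; rewrite !gt_eqF.
have cf : continuous f.
  have df (c : R) : derivable f c 1.
    exact: ex_derive.
  by move=> c; apply/differentiable_continuous/derivable1_diffP.
rewrite -(@integral_itv_bndoo _ _ _ _ true false); last first.
  apply/measurable_EFinP; apply: measurable_funTS.
  exact: continuous_measurable_fun.
rewrite (@continuous_FTC2 _ f F)//.
- rewrite -EFinB; congr EFin; rewrite /F subrr subr0 mul0r expR0 !mulr1 mulr0.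
  rewrite cospi sinpi cos0 sin0 !mul1r.
  by move: p0 q0; generalize (@pi R) => p p0 q0; field; rewrite !gt_eqF.
- exact: continuous_subspaceT.
- have cF := der_continuous dF; split => //.
  + by apply: cvg_at_right_filter; exact: cF.
  + by apply: cvg_at_left_filter; exact: cF.
- by move=> x _; rewrite derive1E; exact: derive_val.
Qed.

Lemma integral_expRN01 (y : R) : 0 < y ->
  (\int[mu]_(c in `]0%R, 1%R[) (expR (- y * c))%:E = ((1 - expR (- y)) / y)%:E)%E.
Proof.
move=> y0.
have dF (x : R) : is_derive x 1 (fun x => - (y^-1 * expR (- y * x))) (expR (- y * x)).
  by der; field; rewrite gt_eqF.
rewrite -(@integral_itv_bndoo _ _ _ _ true false); last first.
  by apply/measurable_EFinP; apply: measurable_funTS; exact: measurable_expRM.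
rewrite (@continuous_FTC2 _ _ (fun x => - (y^-1 * expR (- y * x))))//.
- by rewrite -EFinB; congr EFin; rewrite mulr0 mulr1 expR0; field; rewrite gt_eqF.
- exact/continuous_subspaceT/continuous_expRM.
- have cF := der_continuous dF; split => //.
  + by apply: cvg_at_right_filter; exact: cF.
  + by apply: cvg_at_left_filter; exact: cF.
- by move=> x _; rewrite derive1E; exact: derive_val.
Qed.

(** Translating [s] by [y] leaves [e^(- y c)] times the beta integral at [1 - c], which is
    [pi / sin (pi c)] by symmetry. *)
Lemma integral_beta_kernel_shift (c y : R) : 0 < c < 1 ->
  (\int[mu]_s (expR ((1 - c) * s) / (expR s + expR y))%:E =
   (expR (- y * c) * (pi / sin (pi * c)))%:E)%E.
Proof.
move=> c01; have d01 : 0 < 1 - c < 1 by lra.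
have m : measurable_fun [set: R]
    (fun s : R => (expR ((1 - c) * s) / (expR s + expR y))%:E).
  apply/measurable_EFinP; apply: measurable_funM; first exact: measurable_expRM.
  by apply: measurable_funV; apply: measurable_funD.
rewrite (@ge0_integral_affine _ _ 1 y)//.
rewrite mul1e -[pi / _]/(pi_csc c) -pi_csc_onem -betaR_pi_csc// EFinM -integral_beta_kernel//.
rewrite -ge0_integralZl_EFin ?expR_ge0//; first last.
- by apply/measurable_EFinP; exact: measurable_beta_kernel.
- by move=> s _; rewrite lee_fin ltW// beta_kernel_gt0.
apply: eq_integral => s _; rewrite -EFinM; congr EFin.
have E1 : expR ((1 - c) * (s + y)) = expR ((1 - c) * s) * (expR y / expR (c * y)).
  by rewrite mulrDr expRD; congr (_ * _); rewrite mulrBl mul1r expRD expRN.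
have E2 : expR (- y * c) = (expR (c * y))^-1 by rewrite mulNr expRN mulrC.
rewrite mul1r /beta_kernel E1 E2 expRD.
have := expR_gt0 y; have := expR_gt0 s; have := expR_gt0 (c * y).
generalize (expR y), (expR s), (expR (c * y)) => a b d d0 b0 a0.
have h1 : b * a + a != 0 by rewrite gt_eqF// addr_gt0// mulr_gt0.
have h2 : 1 + b != 0 by rewrite gt_eqF// addr_gt0.
by field; rewrite h1 h2 gt_eqF.
Qed.

(** [integral_sin_expR] turns the first factor into an integral over [0 < c < 1]. After Tonelli's
    theorem the beta integral in [s] contributes [pi / sin (pi c)], which cancels the sine and
    leaves the integral of [e^(- y c)]. *)
Lemma integral_reflection (y : R) : 0 < y ->
  (\int[mu]_s ((1 + expR s) / (s ^+ 2 + pi ^+ 2) / (expR s + expR y))%:E =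
   ((1 - expR (- y)) / y)%:E)%E.
Proof.
move=> y0; have p0 : (0 : R) < pi := @pi_gt0 R.
pose I : set R := `]0, 1[%classic.
pose g (c s : R) := sin (pi * c) / pi * expR ((1 - c) * s) / (expR s + expR y).
pose f (p : R * R) : \bar R := (g p.2 p.1 * \1_I p.2)%:E.
have mf : measurable_fun [set: R * R] f.
  apply/measurable_EFinP; apply: measurable_funM; last first.
    by apply: measurableT_comp => //; apply: measurable_indic; exact: measurable_itv.
  apply: measurable_funM.
    apply: measurable_funM.
      apply: measurable_funM => //.
      apply: measurableT_comp => //.
        by apply: continuous_measurable_fun; exact: continuous_sin.
      by apply: measurable_funM.
    apply: measurableT_comp => //; apply: measurable_funM => //.
    by apply: measurable_funB.
  apply: measurable_funV; apply: measurable_funD => //.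
  exact: measurableT_comp.
have g0 c s : I c -> 0 <= g c s.
  rewrite /I/= in_itv/= => c01.
  rewrite /g mulr_ge0// ?invr_ge0 ?addr_ge0 ?expR_ge0// mulr_ge0 ?expR_ge0//.
  by rewrite divr_ge0 ?(ltW p0)// ltW// sin_gt0_pi// pi_itv.
have f0 p : (0 <= f p)%E.
  rewrite lee_fin indicE; have [/set_mem pI|_] := boolP (p.2 \in I).
    by rewrite mulr1 g0.
  by rewrite mulr0.
transitivity (\int[mu]_s \int[mu]_c f (s, c))%E.
  apply: eq_integral => s _; rewrite /f/= integral_indic_oo /g.
  have e0 : 0 <= (expR s + expR y)^-1 by rewrite invr_ge0 addr_ge0 ?expR_ge0.
  rewrite EFinM -integral_sin_expR -ge0_integralZr//; first last.
  - move=> c; rewrite /= in_itv/= => c01.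
    rewrite lee_fin mulr_ge0 ?expR_ge0// divr_ge0 ?(ltW p0)//.
    by rewrite ltW// sin_gt0_pi// pi_itv.
  - apply/measurable_EFinP; apply: measurable_funTS.
    apply: measurable_funM.
      apply: measurable_funM => //; apply: measurableT_comp => //.
        by apply: continuous_measurable_fun; exact: continuous_sin.
    apply: measurableT_comp => //; apply: measurable_funM => //.
    exact: measurable_funB.
rewrite fubini_tonelli//.
rewrite -integral_expRN01// -integral_indic_oo.
apply: eq_integral => c _; rewrite /f/= -/I.
have [/set_mem cI|cI] := boolP (c \in I); last first.
  rewrite indicE (negbTE cI) mulr0.
  by under eq_integral do rewrite mulr0; rewrite integral0.
rewrite indicE mem_set// mulr1.
have c01 : 0 < c < 1 by move: cI; rewrite /I/= in_itv.
have s0 : 0 < sin (pi * c) by rewrite sin_gt0_pi// pi_itv.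
under eq_integral do rewrite mulr1 /g -mulrA EFinM.
rewrite ge0_integralZl_EFin//.
- rewrite integral_beta_kernel_shift// -EFinM; congr EFin.
  by move: p0 s0; generalize (sin (pi * c)), (@pi R) => a p p0 a0; field; rewrite !gt_eqF.
- apply/measurable_EFinP; apply: measurable_funM; first exact: measurable_expRM.
  by apply: measurable_funV; apply: measurable_funD.
- by rewrite divr_ge0 ?(ltW p0)// ltW.
Qed.

Lemma measurable_sqrDpiV : measurable_fun [set: R] (fun s : R => (s ^+ 2 + pi ^+ 2)^-1).
Proof. by apply: measurable_funV; apply: measurable_funD. Qed.

Lemma integral_cauchy : (\int[mu]_s ((s ^+ 2 + pi ^+ 2)^-1 : R)%:E = 1)%E.
Proof.
have p0 : (0 : R) < pi := @pi_gt0 R.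
have dF (s : R) : is_derive s 1 (fun s => atan (s / pi) / pi) (s ^+ 2 + pi ^+ 2)^-1.
  der; have := sqrDpi_gt0 s => q0.
  move: p0 q0; generalize (atan (s / pi)); generalize (@pi R) => p a p0 q0.
  by field; rewrite !gt_eqF.
have cv : atan (s / pi) / pi @[s --> +oo] --> (1 / 2 : R).
  rewrite [X in _ --> X](_ : _ = pi / 2 / pi); last first.
    by move: p0; generalize (@pi R) => p p0; field; rewrite gt_eqF.
  apply: cvgM; last exact: cvg_cst.
  apply: (@cvg_comp _ _ _ (fun s : R => s / pi) (@atan R) _ (pinfty_nbhs R)).
    by apply: gt0_cvgMly; rewrite ?invr_gt0.
  exact: cvgy_atan.
rewrite [RHS](_ : _ = (1 / 2 - - (1 / 2) : R)%:E); last by congr EFin; field.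
apply: (@ge0_integralT_FTC _ _ (fun s => atan (s / pi) / pi)) => //.
- by move=> s; rewrite invr_ge0 ltW// sqrDpi_gt0.
- move=> s; apply: cvgV; first by rewrite gt_eqF// sqrDpi_gt0.
  by apply: cvgD; [exact: exprn_continuous|exact: cvg_cst].
- apply/cvgNy_compNP.
  rewrite (_ : _ \o _ = (fun s => - (atan (s / pi) / pi))); last first.
    by apply/funext => s /=; rewrite mulNr atanN mulNr.
  exact: cvgN.
Qed.

(** Since [(1 + e^s) / (e^s + e^y) = e^(-y) + (1 - e^(-y)) e^s / (e^s + e^y)], [integral_reflection]
    and [integral_cauchy] give a linear equation for this integral. *)
Lemma integral_cauchy_logistic (y : R) : 0 < y ->
  (\int[mu]_s ((s ^+ 2 + pi ^+ 2)^-1 * (expR s / (expR s + expR y)))%:E =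
   (y^-1 - (expR y - 1)^-1)%:E)%E.
Proof.
move=> y0; have ey := expR_gt0 y.
have ey1 : 0 < expR y - 1 by rewrite subr_gt0 expR_gt1.
have m0 := measurable_sqrDpiV.
have m1 : measurable_fun [set: R] (fun s : R =>
    (s ^+ 2 + pi ^+ 2)^-1 * (expR s / (expR s + expR y))).
  apply: measurable_funM => //; apply: measurable_funM => //.
  by apply: measurable_funV; apply: measurable_funD.
have n0 (s : R) : 0 <= (s ^+ 2 + pi ^+ 2)^-1 by rewrite invr_ge0 ltW// sqrDpi_gt0.
have n1 (s : R) : 0 <= (s ^+ 2 + pi ^+ 2)^-1 * (expR s / (expR s + expR y)).
  by rewrite mulr_ge0// divr_ge0 ?addr_ge0 ?expR_ge0.
set T := (X in X = _).
(* Finiteness permits solving the linear equation in the reals. *)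
have Tfin : T \is a fin_num.
  rewrite ge0_fin_numE; last by apply: integral_ge0 => s _; rewrite lee_fin.
  apply: (@le_lt_trans _ _ 1%E); last by rewrite ltry.
  rewrite -integral_cauchy; apply: ge0_le_integral => //.
  - by move=> s _; rewrite lee_fin.
  - exact/measurable_EFinP.
  - exact/measurable_EFinP.
  - move=> s _; rewrite lee_fin ler_piMr//.
    by rewrite ler_pdivrMr ?mul1r ?addr_gt0 ?expR_gt0// lerDl expR_ge0.
have eN : expR (- y) < 1 by rewrite expR_lt1 oppr_lt0.
have : ((expR (- y))%:E + (1 - expR (- y))%:E * T = ((1 - expR (- y)) / y)%:E)%E.
  rewrite -integral_reflection// -[X in (X + _)%E]mule1 -integral_cauchy.
  rewrite -!ge0_integralZl_EFin ?expR_ge0//; last 5 first.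
  - by move=> s _; rewrite lee_fin.
  - exact/measurable_EFinP.
  - by rewrite subr_ge0 ltW.
  - by move=> s _; rewrite lee_fin.
  - exact/measurable_EFinP.
  rewrite -ge0_integralD//; last 4 first.
  - by move=> s _; rewrite -EFinM lee_fin mulr_ge0// expR_ge0.
  - by apply: measurable_funeM; exact/measurable_EFinP.
  - by move=> s _; rewrite -EFinM lee_fin mulr_ge0// subr_ge0 ltW.
  - by apply: measurable_funeM; exact/measurable_EFinP.
  apply: eq_integral => s _; rewrite -!EFinM -EFinD; congr EFin.
  have := sqrDpi_gt0 s; have es := expR_gt0 s; rewrite expRN => q0.
  move: q0; generalize (@pi R) => p q0.
  by field; rewrite (gt_eqF q0) (gt_eqF ey) gt_eqF// addr_gt0.
clearbody T; rewrite -(fineK Tfin) -EFinM -EFinD => h.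
have {}h := EFin_inj h; congr EFin.
rewrite expRN in h eN.
have d0 : 1 - (expR y)^-1 != 0 by rewrite subr_eq0 gt_eqF.
apply: (mulfI d0); apply: (addrI (expR y)^-1); rewrite h.
by field; rewrite !gt_eqF.
Qed.

Definition weight (u : R) : R := (ln (u - 1) ^+ 2 + pi ^+ 2)^-1.

Lemma weight_ge0 u : 0 <= weight u.
Proof. by rewrite invr_ge0 ltW// sqrDpi_gt0. Qed.

Lemma measurable_weight : measurable_fun [set: R] weight.
Proof.
apply: (measurableT_comp measurable_sqrDpiV).
apply: measurableT_comp; first exact: measurable_ln.
exact: measurable_funB.
Qed.

(** The substitution [u = 1 + e^s] turns [weight u] into [1 / (s^2 + pi^2)] and the denominator into
    [e^s + e^y]. With [y = 1/t] this is the case [m = 0]. *)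
Lemma integral_weight (y : R) : 0 < y ->
  (\int[mu]_(u in `]1%R, +oo[) (weight u * (expR y - 1 + u)^-1)%:E =
   (y^-1 - (expR y - 1)^-1)%:E)%E.
Proof.
move=> y0; have ey := expR_gt0 y.
have ey1 : 0 < expR y - 1 by rewrite subr_gt0 expR_gt1.
rewrite (@ge0_integral_oneDexpR _ (fun u => weight u * (expR y - 1 + u)^-1)).
- rewrite -integral_cauchy_logistic//; apply: eq_integral => s _.
  rewrite /weight (addrC 1) addrK expRK; congr EFin.
  rewrite (_ : expR y - 1 + (expR s + 1) = expR s + expR y); last by ring.
  by rewrite -mulrA [_^-1 * expR s]mulrC.
- move=> u u1; rewrite mulr_ge0 ?weight_ge0// invr_ge0 addr_ge0 ?(ltW ey1)//.
  by rewrite ltW// (lt_trans _ u1).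
- move=> u; rewrite in_itv/= andbT => u1; apply: cvgM.
    apply: cvgV; first by rewrite gt_eqF// sqrDpi_gt0.
    apply: cvgD; last exact: cvg_cst.
    apply: (@continuous_comp _ _ _ (fun u : R => ln (u - 1)) (fun x => x ^+ 2)).
      apply: (@continuous_comp _ _ _ (fun u : R => u - 1) (@ln R)).
        by apply: cvgB; [exact: cvg_id|exact: cvg_cst].
      by apply: continuous_ln; rewrite subr_gt0.
    exact: exprn_continuous.
  apply: cvgV; first by rewrite gt_eqF// addr_gt0// (lt_trans _ u1).
  by apply: cvgD; [exact: cvg_cst|exact: cvg_id].
Qed.

End kernel.

(** * Differentiation under the integral sign *)

Section kernel_terms.
Context {R : realType}.
Local Notation mu := (@lebesgue_measure R).

(* [(c, p, a, b)] stands for [c t^(-p) E^a (E - 1 + u)^(-(b + 1))] where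
   [E = e^(1/t)]; sums of such terms are closed under differentiation in [t].  The
   value [u = 0] gives the terms outside the integral. *)
Definition kterm : Type := R * nat * nat * nat.

Definition tval (x : kterm) (u t : R) : R :=
  let: (c, p, a, b) := x in
  c * t^-1 ^+ p * expR t^-1 ^+ a * (expR t^-1 - 1 + u)^-1 ^+ b.+1.

(** One term per factor in the product rule. Differentiating [e^(1/t)] brings out [- t^(-2)], hence
    [p.+2]; in the last term the two signs cancel. *)
Definition tder (x : kterm) : seq kterm :=
  let: (c, p, a, b) := x in
  [:: (- (c * p%:R), p.+1, a, b); (- (c * a%:R), p.+2, a, b);
      (c * b.+1%:R, p.+2, a.+1, b.+1)].

Definition kval (s : seq kterm) (u t : R) : R := \sum_(x <- s) tval x u t.
Definition kder (s : seq kterm) : seq kterm := flatten [seq tder x | x <- s].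

Lemma kval_cons x s u t : kval (x :: s) u t = tval x u t + kval s u t.
Proof. by rewrite /kval big_cons. Qed.

Lemma kder_cons x s u t : kval (kder (x :: s)) u t = kval (tder x) u t + kval (kder s) u t.
Proof. by rewrite /kval /kder /= big_cat. Qed.

Lemma expRV_gt1 (t : R) : 0 < t -> 0 < expR t^-1 - 1.
Proof. by move=> t0; rewrite subr_gt0 expR_gt1 invr_gt0. Qed.

Lemma is_derive_exprV (p : nat) (t : R) : 0 < t ->
  is_derive t 1 (fun t => (t^-1 : R) ^+ p) (- (p%:R * (t^-1 : R) ^+ p.+1)).
Proof.
move=> t0; have tn0 : t != 0 by rewrite gt_eqF.
der => //; case: p => [|p]; first by rewrite !mul0r oppr0.
rewrite /= !exprS !expr0; generalize ((t^-1 : R) ^+ p) => tp; by field.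
Qed.

Lemma is_derive_expRV (a : nat) (t : R) : 0 < t ->
  is_derive t 1 (fun t => expR t^-1 ^+ a) (- (a%:R * t^-1 ^+ 2 * expR t^-1 ^+ a)).
Proof.
move=> t0; have tn0 : t != 0 by rewrite gt_eqF.
der => //; case: a => [|a]; first by rewrite !mul0r oppr0.
rewrite /= !exprS !expr0; generalize (expR t^-1 ^+ a), (expR t^-1) => Ea E; by field.
Qed.

Lemma is_derive_resolvent (b : nat) (u t : R) : 0 <= u -> 0 < t ->
  is_derive t 1 (fun t => ((expR t^-1 - 1 + u)^-1 : R) ^+ b.+1)
    (b.+1%:R * (t^-1 : R) ^+ 2 * expR t^-1 * ((expR t^-1 - 1 + u)^-1 : R) ^+ b.+2).
Proof.
move=> u0 t0; have tn0 : t != 0 by rewrite gt_eqF.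
have z0 : expR t^-1 - 1 + u != 0 by rewrite gt_eqF// ltr_wpDr// expRV_gt1.
der => //; rewrite /= !exprS !expr0.
move: z0; generalize (expR t^-1) => E z0.
generalize (((E - 1 + u)^-1 : R) ^+ b) => zb; field. by rewrite ?z0 ?tn0 ?z0.
Qed.

Lemma is_derive_tval x (u t : R) : 0 <= u -> 0 < t ->
  is_derive t 1 (tval x u) (kval (tder x) u t).
Proof.
case: x => [[[c p] a] b] u0 t0.
have dA := is_derive_exprV p t0; have dB := is_derive_expRV a t0.
have dC := is_derive_resolvent b u0 t0.
rewrite /tval; der.
rewrite /kval /tder !big_cons big_nil /tval !exprS !expr0.
by ring.
Qed.

Lemma is_derive_kval s (u t : R) : 0 <= u -> 0 < t ->
  is_derive t 1 (kval s u) (kval (kder s) u t).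
Proof.
move=> u0 t0; elim: s => [|x s ih].
  have -> : kval [::] u = (fun=> 0) by apply/funext => y; rewrite /kval big_nil.
  exact: der_cst.
have -> : kval (x :: s) u = (fun y => tval x u y + kval s u y).
  by apply/funext => y; rewrite kval_cons.
rewrite kder_cons; apply: der_add => //; exact: is_derive_tval.
Qed.

(* The case [m = 0], [t = 1] of the integrand, which is already known to be
   integrable against [weight]. *)
Definition majorant (u : R) : R := (expR 1 - 1 + u)^-1.

Lemma majorant_gt0 u : 1 < u -> 0 < majorant u.
Proof.
by move=> u1; rewrite invr_gt0 addr_gt0 ?subr_gt0 ?expR_gt1// (lt_trans _ u1).
Qed.

(** For [t >= t0] the powers of [1/t] and [e^(1/t)] are at most their values at [t0]. That one
    constant serves all such [t] gives the domination needed to differentiate under the integral. *)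
Lemma kval_bound s (t0 : R) : 0 < t0 ->
  exists2 C : R, 0 <= C & forall u t, 1 < u -> t0 <= t -> `|kval s u t| <= C * majorant u.
Proof.
move=> t00; elim: s => [|[[[c p] a] b] s [C C0 hC]].
  by exists 0 => // u t _ _; rewrite /kval big_nil normr0 mul0r.
exists (`|c| * t0^-1 ^+ p * expR t0^-1 ^+ a * expR 1 + C).
  by rewrite addr_ge0// !mulr_ge0 ?exprn_ge0 ?invr_ge0 ?expR_ge0// ltW.
move=> u t u1 tt0; have t_gt0 : 0 < t by exact: lt_le_trans tt0.
have u0 : 0 < u by exact: lt_trans u1.
rewrite kval_cons; apply: (le_trans (ler_normD _ _)); rewrite mulrDl lerD ?hC//.
have e0 := expRV_gt1 t_gt0.
have Vt : t^-1 <= t0^-1 by rewrite lef_pV2 ?posrE.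
have z1 : (expR t^-1 - 1 + u)^-1 <= u^-1.
  have zz : 0 < expR t^-1 - 1 + u by rewrite addr_gt0.
  by rewrite lef_pV2 ?posrE// lerDr ltW.
have z0 : 0 <= (expR t^-1 - 1 + u)^-1 by rewrite invr_ge0 addr_ge0// ltW.
(* The base is at most [1/u <= 1], so the power is at most [1/u]; and [e - 1 + u <= e u] for
   [u >= 1]. *)
have zb : (expR t^-1 - 1 + u)^-1 ^+ b.+1 <= expR 1 * majorant u.
  apply: (@le_trans _ _ (expR t^-1 - 1 + u)^-1).
    rewrite exprS ler_piMr// exprn_ile1// (le_trans z1)// invf_le1// ltW//.
  apply: (le_trans z1); rewrite /majorant.
  have e1 : 0 < expR 1 - 1 :> R by rewrite subr_gt0 expR_gt1.
  have zz : 0 < expR 1 - 1 + u by rewrite addr_gt0.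
  by rewrite ler_pdivlMr// mulrC ler_pdivrMr//; nra.
rewrite /tval !normrM !normrX [`|t^-1|]ger0_norm ?invr_ge0 ?(ltW t_gt0)//.
rewrite [`|expR _|]ger0_norm ?expR_ge0// [`|(_ + _)^-1|]ger0_norm// -[leRHS]mulrA.
have t1 : 0 <= t^-1 by rewrite invr_ge0 ltW.
apply: ler_pM => //; rewrite ?exprn_ge0// ?mulr_ge0 ?exprn_ge0 ?expR_ge0//.
apply: ler_pM => //; rewrite ?exprn_ge0// ?mulr_ge0 ?exprn_ge0 ?expR_ge0//.
  by rewrite ler_wpM2l// lerXn2r// nnegrE// invr_ge0 ltW.
by rewrite lerXn2r// ?nnegrE ?expR_ge0// ler_expR.
Qed.

Lemma measurable_tval x (t : R) : measurable_fun [set: R] (tval x ^~ t).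
Proof.
case: x => [[[c p] a] b]; rewrite /tval; apply: measurable_funM => //.
apply: measurable_funX; apply: measurable_funV.
exact: measurable_funD.
Qed.

Lemma measurable_kval s (t : R) : measurable_fun [set: R] (kval s ^~ t).
Proof.
elim: s => [|x s ih].
  rewrite (_ : (kval [::])^~ t = cst 0); first exact: measurable_cst.
  by apply/funext => y; rewrite /kval big_nil.
under eq_fun do rewrite kval_cons.
by apply: measurable_funD => //; exact: measurable_tval.
Qed.

Lemma integrable_weight_majorant :
  mu.-integrable `]1, +oo[ (EFin \o (fun u => weight u * majorant u)).
Proof.
apply/integrableP; split.
  apply/measurable_EFinP; apply: measurable_funTS; apply: measurable_funM.
    exact: measurable_weight.
  by apply: measurable_funV; exact: measurable_funD.
have -> : (\int[mu]_(u in `]1%R, +oo[) `|(EFin \o (fun u => weight u * majorant u)%R) u| =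
    \int[mu]_(u in `]1%R, +oo[) (weight u * majorant u)%:E)%E; last first.
  by rewrite (integral_weight ltr01) ltry.
apply: eq_integral => u; rewrite inE/= in_itv/= andbT => u1.
by rewrite /= ger0_norm// mulr_ge0 ?weight_ge0// ltW// majorant_gt0.
Qed.

Lemma integrable_kval s (t : R) : 0 < t ->
  mu.-integrable `]1, +oo[ (EFin \o (fun u => weight u * kval s u t)).
Proof.
move=> t0; have [C C0 hC] := kval_bound s t0.
apply: (le_integrable _ _ _ (integrableZl _ C integrable_weight_majorant)) => //.
- apply/measurable_EFinP; apply: measurable_funTS.
  by apply: measurable_funM; [exact: measurable_weight|exact: measurable_kval].
- move=> u; rewrite /= in_itv/= andbT => u1; rewrite lee_fin.
  rewrite normrM ger0_norm ?weight_ge0// [leRHS]ger0_norm; last first.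
    by rewrite !mulr_ge0 ?weight_ge0// ltW// majorant_gt0.
  by rewrite mulrCA ler_wpM2l ?weight_ge0// hC.
Qed.

Definition kint (s : seq kterm) (t : R) : R :=
  kval s 0 t + \int[mu]_(u in `]1, +oo[) (weight u * kval s u t).

(** Dominated differentiation on []t / 2, t + 1[]: staying above [t / 2 > 0] gives a single constant
    in [kval_bound]. *)
Lemma is_derive_kint s (t : R) : 0 < t -> is_derive t 1 (kint s) (kint (kder s) t).
Proof.
move=> t0; apply: der_add; first exact: is_derive_kval.
have t20 : 0 < t / 2 by rewrite divr_gt0.
have [C C0 hC] := kval_bound (kder s) t20.
pose f (x u : R) := weight u * kval s u x.
(* The absolute value makes [G] nonnegative for every real [u], also where [majorant] is
   negative. *)
pose G (u : R) := `|C * (weight u * majorant u)|.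
have It : (`]t / 2, t + 1[%classic : set R) t.
  by rewrite /= in_itv/=; apply/andP; split; [rewrite ltr_pdivrMr//; lra|lra].
have Ip x : (`]t / 2, t + 1[%classic : set R) x -> 0 < x.
  by rewrite /= in_itv/= => /andP[+ _]; exact: lt_trans.
have df x u : (`]t / 2, t + 1[%classic : set R) x -> (`]1, +oo[%classic : set R) u ->
    is_derive x 1 (f ^~ u) (weight u * kval (kder s) u x).
  rewrite [X in _ -> X -> _]/= in_itv/= andbT => /Ip x0 u1.
  have d := @is_derive_kval s u x (ltW (lt_trans ltr01 u1)) x0.
  by rewrite /f; der; rewrite mul0r add0r.
have d1 x u : (`]t / 2, t + 1[%classic : set R) x -> (`]1, +oo[%classic : set R) u ->
    partial1of2 f x u = weight u * kval (kder s) u x.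
  by move=> Ix Iu; rewrite partial1of2E (derive_val (is_derive := df _ _ Ix Iu)).
have intf x : (`]t / 2, t + 1[%classic : set R) x -> mu.-integrable `]1, +oo[ (EFin \o f x).
  by move=> /Ip x0; exact: integrable_kval.
have derf x u : (`]t / 2, t + 1[%classic : set R) x -> (`]1, +oo[%classic : set R) u ->
    derivable (f ^~ u) x 1.
  by move=> Ix Iu; apply: ex_derive; exact: df.
have G0 u : 0 <= G u by exact: normr_ge0.
have intG : mu.-integrable `]1, +oo[ (EFin \o G).
  apply: (@integrable_norm _ _ _ mu _ (fun u => C * (weight u * majorant u))).
  exact: (integrableZl _ C integrable_weight_majorant).
have Gub x u : (`]t / 2, t + 1[%classic : set R) x -> (`]1, +oo[%classic : set R) u ->
    `|partial1of2 f x u| <= G u.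
  move=> Ix Iu; rewrite d1// /G; move: Ix Iu.
  rewrite /= !in_itv/= andbT => /andP[x1 _] u1.
  rewrite normrM ger0_norm ?weight_ge0// [leRHS]ger0_norm; last first.
    by rewrite !mulr_ge0 ?weight_ge0// ltW// majorant_gt0.
  by rewrite mulrCA ler_wpM2l ?weight_ge0// hC// ltW.
have mI : measurable (`]1, +oo[%classic : set (measurableTypeR R)) by exact: measurable_itv.
apply: DeriveDef.
  exact: (derivable_under_integral mI It intf derf G0 intG Gub).
rewrite -derive1E.
rewrite (differentiation_under_integral mI It intf derf G0 intG Gub).
by apply: eq_Rintegral => u; rewrite inE => Iu; rewrite d1.
Qed.

(** The hypothesis at [u = 0] handles the term outside the integral and at [u > 1] the integrand, so
    pointwise identities transfer to [kint]. *)
Lemma kint_lin s1 s2 s3 (a1 a2 a3 t : R) : 0 < t ->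
  (forall u, 0 <= u -> a1 * kval s1 u t + a2 * kval s2 u t = a3 * kval s3 u t) ->
  a1 * kint s1 t + a2 * kint s2 t = a3 * kint s3 t.
Proof.
move=> t0 h; rewrite /kint !mulrDr addrACA h//; congr (_ + _).
have i s := integrable_kval s t0.
have iZ s (a : R) : mu.-integrable `]1, +oo[ (EFin \o (fun u => a * (weight u * kval s u t))).
  by apply: (integrableZl _ a (i s)).
rewrite -!RintegralZl//; [|exact: i..].
rewrite -RintegralD//; [|exact: iZ..].
apply: eq_Rintegral => u; rewrite inE/= in_itv/= andbT => u1.
rewrite ![_ * (weight u * _)]mulrCA -mulrDr h// ltW// (lt_trans _ u1)//.
Qed.

Definition stirling_kernel (m : nat) : seq kterm := [:: (1, 0%N, m, m)].

Lemma kval_kern m u t :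
  kval (stirling_kernel m) u t = expR t^-1 ^+ m * (expR t^-1 - 1 + u)^-1 ^+ m.+1.
Proof. by rewrite /kval big_seq1 /tval expr0 !mul1r. Qed.

(** In [integral_weight] at [y = 1/t], the term [- 1 / (e^(1/t) - 1)] cancels the value at
    [u = 0]. *)
Lemma kint_kernel0 (t : R) : 0 < t -> kint (stirling_kernel 0) t = t.
Proof.
move=> t0; rewrite /kint kval_kern expr0 mul1r addr0 expr1.
under eq_Rintegral do rewrite kval_kern expr0 mul1r expr1.
by rewrite /Rintegral integral_weight ?invr_gt0//= invrK addrC subrK.
Qed.

(** Pointwise in [u], [t^2 d/dt] sends [E^m z^(m+1)] to [- m E^m z^(m+1) + (m+1) E^(m+1) z^(m+2)],
    where [E = e^(1/t)] and [z = 1 / (E - 1 + u)]. *)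
Lemma kint_kernelS m (t : R) : 0 < t ->
  t ^+ 2 * kint (kder (stirling_kernel m)) t + m%:R * kint (stirling_kernel m) t =
  m.+1%:R * kint (stirling_kernel m.+1) t.
Proof.
move=> t0; apply: kint_lin => // u u0.
rewrite !kval_kern /kder /= /kval !big_cons big_nil /tval.
rewrite !exprS !expr0.
generalize ((expR t^-1 - 1 + u)^-1) => z; generalize (expR t^-1) => E.
by field; rewrite gt_eqF.
Qed.

End kernel_terms.

(** * Stirling polynomials *)

Section stirling.
Context {R : realType}.

Lemma stirling1S n k : stirling1 n.+1 k =
  (if k is k'.+1 then stirling1 n k' else 0) - stirling1 n k * n%:Z.
Proof.
rewrite /stirling1 big_ord_recr /= mulrBr coefB coefMX coefMC.
by case: k.
Qed.

Lemma stirling10 k : stirling1 0 k = (k == 0%N)%:R.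
Proof. by rewrite /stirling1 big_ord0 coef1. Qed.

Lemma stirling1_gt n k : (n < k)%N -> stirling1 n k = 0.
Proof.
elim: n k => [|n ih] [|k]//; first by rewrite stirling10.
by rewrite ltnS => nk; rewrite stirling1S !ih ?mul0r ?subr0// ltnW.
Qed.

Definition acoef (m i : nat) : R := (-1) ^+ (m + i) * i`!%:R * (stirling1 m i)%:~R.

Lemma acoef_gt m i : (m < i)%N -> acoef m i = 0.
Proof. by move=> mi; rewrite /acoef stirling1_gt// mulr0z mulr0. Qed.

(** The sign [(-1)^(m+i)] turns the subtraction in the Stirling recurrence into a sum, and
    [(i+1)! = (i+1) i!] supplies the first factor. *)
Lemma acoefS m i : acoef m.+1 i.+1 = i.+1%:R * acoef m i + m%:R * acoef m i.+1.
Proof.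
rewrite /acoef stirling1S rmorphB rmorphM/= factS natrM.
rewrite !addSn !addnS !exprS -[m%:~R]/(m%:R).
by ring.
Qed.

Lemma acoefS0 m : acoef m.+1 0 = m%:R * acoef m 0.
Proof.
rewrite /acoef stirling1S rmorphB rmorphM/= !addn0 exprS -[m%:~R]/(m%:R).
by ring.
Qed.

Definition apoly (m : nat) : {poly R} := \sum_(i < m.+1) acoef m i *: 'X^(i.+1).

Lemma coef_apolyS m i : (apoly m)`_i.+1 = acoef m i.
Proof.
rewrite /apoly coef_sum; have [im|mi] := leqP i m; last first.
  rewrite acoef_gt// big1// => j _; rewrite coefZ coefXn eqSS.
  by rewrite gtn_eqF ?mulr0//; apply: (leq_trans (ltn_ord j)).
rewrite (bigD1 (Ordinal (im : (i < m.+1)%N)))//= coefZ coefXn eqxx mulr1.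
rewrite big1 ?addr0// => j ji; rewrite coefZ coefXn eqSS.
by rewrite (_ : (i == j) = false) ?mulr0//; apply/negbTE; rewrite eq_sym.
Qed.

Lemma coef_apoly0 m : (apoly m)`_0 = 0.
Proof. by rewrite /apoly coef_sum big1// => j _; rewrite coefZ coefXn mulr0. Qed.

(** Coefficientwise this is [acoefS]: ['X^2] times the derivative moves degree [i.+1] to [i.+2] with
    factor [i.+1]. *)
Lemma apolyS m : apoly m.+1 = 'X^2 * (apoly m)^`() + m%:R *: apoly m.
Proof.
apply/polyP => -[|i].
  by rewrite coef_apoly0 coefD coefXnM/= coefZ coef_apoly0 mulr0 addr0.
rewrite coef_apolyS coefD coefXnM coefZ coef_apolyS.
case: i => [|i]; first by rewrite /= add0r acoefS0.
rewrite /= !subSS subn0 coef_deriv coef_apolyS acoefS; congr (_ + _).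
by rewrite mulr_natl.
Qed.

Lemma apoly0 : apoly 0 = 'X.
Proof.
by rewrite /apoly big_ord1 /acoef stirling10 expr0 fact0 !mulr1 scale1r expr1.
Qed.

(** Both sides are [t] for [m = 0] and obey the same recurrence in [m]. *)
Lemma apolyE m (t : R) : 0 < t -> (apoly m).[t] = m`!%:R * kint (stirling_kernel m) t.
Proof.
elim: m t => [|m ih] t t0; first by rewrite apoly0 hornerX kint_kernel0// fact0 mul1r.
have d1 := is_derive_poly (apoly m) t.
have d2 : is_derive t 1 (fun t => m`!%:R * kint (stirling_kernel m) t)
    (m`!%:R * kint (kder (stirling_kernel m)) t).
  have dH := is_derive_kint (stirling_kernel m) t0.
  by der; rewrite mul0r add0r.
(* The induction hypothesis holds at all [y > 0], hence near [t], so the derivatives at [t] agree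
   too. *)
have e : (apoly m)^`().[t] = m`!%:R * kint (kder (stirling_kernel m)) t.
  rewrite -(derive_val (is_derive := d1)) -(derive_val (is_derive := d2)).
  apply: near_eq_derive; near=> y; apply: ih.
  by near: y; exact: lt_nbhsr.
rewrite apolyS hornerD hornerM hornerXn hornerZ e ih//.
rewrite factS natrM -[in RHS]mulrA mulrCA -mulrA [RHS]mulrCA -kint_kernelS//.
by ring.
Unshelve. all: by end_near. Qed.

Lemma apoly_derivn m k (t : R) : 0 < t ->
  (apoly m)^`(k).[t] = m`!%:R * kint (iter k kder (stirling_kernel m)) t.
Proof.
elim: k t => [|k ih] t t0; first by rewrite derivn0 apolyE.
have d1 := is_derive_poly ((apoly m)^`(k)) t.
have d2 : is_derive t 1 (fun t => m`!%:R * kint (iter k kder (stirling_kernel m)) t)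
    (m`!%:R * kint (iter k.+1 kder (stirling_kernel m)) t).
  have dH := is_derive_kint (iter k kder (stirling_kernel m)) t0.
  by der; rewrite mul0r add0r.
rewrite derivnS -(derive_val (is_derive := d1)) -(derive_val (is_derive := d2)).
apply: near_eq_derive; near=> y; apply: ih.
by near: y; exact: lt_nbhsr.
Unshelve. all: by end_near. Qed.

(** At [1] the [k]-th derivative of [t^(i+1)] is [(i+1)! / (i+1-k)!] if [i >= k - 1] and [0]
    otherwise, whence the lower limit of the sum. *)
Lemma apoly_derivn1 m k : (0 < k)%N -> (k <= m.+1)%N ->
  (apoly m)^`(k).[1] = \sum_(k.-1 <= i < m.+1)
        (-1) ^+ (m + i) * i`!%:R * (i.+1)`!%:R * (stirling1 m i)%:~R
          / (i.+1 - k)`!%:R.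
Proof.
move=> k0 km; rewrite /apoly linear_sum/= horner_sum -(big_mkord xpredT
  (fun i => ((acoef m i *: 'X^(i.+1))^`(k)).[1])).
rewrite (@big_cat_nat _ _ _ k.-1)//=; last by rewrite (leq_trans (leq_pred _)).
rewrite big_nat big1 ?add0r; last first.
  move=> i /andP[_ ik]; rewrite derivnZ derivnXn ffact_small; last first.
    by rewrite -(prednK k0) ltnS.
  by rewrite mulr0n scaler0 horner0.
rewrite big_nat [RHS]big_nat; apply: eq_bigr => i /andP[ik _].
have ki : (k <= i.+1)%N by rewrite -(prednK k0) ltnS.
rewrite derivnZ derivnXn hornerZ hornerMn hornerXn expr1n.
rewrite -(ffact_fact ki) natrM /acoef.
by field; rewrite pnatr_eq0 -lt0n fact_gt0.
Qed.

(** * Iterated derivatives on the positive half-line and their limits at [1] *)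

Lemma derive1n_chain (g : R -> R) (f : nat -> R -> R) :
  (forall t : R, 0 < t -> g t = f 0 t) ->
  (forall (j : nat) (t : R), 0 < t -> is_derive t 1 (f j) (f j.+1 t)) ->
  forall (k : nat) (t : R), 0 < t ->
    derive1n k g t = f k t /\ is_derive t 1 (derive1n k g) (f k.+1 t).
Proof.
move=> gf df.
(* The half-line is open, so [h] and [f k] agree near [t] and have the same derivative there. *)
have step (h : R -> R) k (t : R) : 0 < t -> (forall y, 0 < y -> h y = f k y) ->
    is_derive t 1 h (f k.+1 t).
  move=> t0 hf; apply: (near_eq_is_derive _ (df k t t0)).
  by near=> y; rewrite hf//; near: y; exact: lt_nbhsr.
elim=> [|k ih] t t0; first by split; [exact: gf|exact: step].
have e y : 0 < y -> derive1n k.+1 g y = f k.+1 y.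
  move=> y0; rewrite derive1nS derive1E.
  exact: (derive_val (is_derive := (ih y y0).2)).
by split; [exact: e|exact: step].
Unshelve. all: by end_near. Qed.

(** The [k]-th derivative is itself differentiable at [1], hence continuous there, so its limit is
    its value. *)
Lemma deriv_lim_chain (g : R -> R) (f : nat -> R -> R) k :
  (forall t : R, 0 < t -> g t = f 0 t) ->
  (forall (j : nat) (t : R), 0 < t -> is_derive t 1 (f j) (f j.+1 t)) ->
  deriv_lim_exists k g 1 /\ deriv_lim k g 1 = f k 1.
Proof.
move=> gf df; have ch := derive1n_chain gf df.
have cv : derive1n k g t @[t --> (1 : R)^'] --> f k 1.
  rewrite -(ch k 1 ltr01).1; apply: cvg_within_filter.
  have d : differentiable (derive1n k g) (1 : R).
    by apply/derivable1_diffP; apply: ex_derive; exact: (ch k 1 ltr01).2.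
  exact: differentiable_continuous d.
split; last exact: cvg_lim.
split; last by apply/cvg_ex; exists (f k 1).
apply: nbhs_dnbhs; near=> t => j _.
have t0 : 0 < t by near: t; exact: lt_nbhsr.
by apply: ex_derive; exact: (ch j t t0).2.
Unshelve. all: by end_near. Qed.

End stirling.

(** * The [k]-th derivative of the identity at [t = 1] *)

Unset Implicit Arguments.
Set Strict Implicit.

Theorem theorem4p2 (R : realType) (m k : nat)
    (hk1 : (1 <= k)%N) (hkm : (k <= m.+1)%N) :
  let f := fun t : R => expR (m%:R / t) / (expR (1 / t) - 1) ^+ m.+1 in
  let g := fun u t : R => expR (m%:R / t) / (expR (1 / t) - 1 + u) ^+ m.+1 in
  let h := fun u : R =>
    1 / (ln (u - 1) ^+ 2 + pi ^+ 2) * deriv_lim k (g u) 1 in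
  [/\ deriv_lim_exists k f 1,
      forall u : R, 1 < u -> deriv_lim_exists k (g u) 1,
      (@lebesgue_measure R).-integrable `]1, +oo[ (fun u => (h u)%:E)
    & \sum_(k.-1 <= i < m.+1)
        (-1) ^+ (m + i) * i`!%:R * (i.+1)`!%:R * (stirling1 m i)%:~R
          / (i.+1 - k)`!%:R
      = m`!%:R * (deriv_lim k f 1
                  + \int[@lebesgue_measure R]_(u in `]1, +oo[) h u) ].
Proof.
(* [s j] lists the terms of the [j]-th derivative in [t] of the integrand. *)
pose s j := @iter (seq (@kterm R)) j (@kder R) (stirling_kernel m).
have gE (u t : R) : expR (m%:R / t) / (expR (1 / t) - 1 + u) ^+ m.+1 = kval (s 0%N) u t.
  by rewrite /s/= kval_kern -expRM_natl !mul1r exprVn.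
have ch u (g0 : R -> R) : 0 <= u -> (forall t, g0 t = kval (s 0%N) u t) ->
    deriv_lim_exists k g0 1 /\ deriv_lim k g0 1 = kval (s k) u 1.
  move=> u0 g0E; apply: (@deriv_lim_chain _ g0 (fun j => kval (s j) u)).
    by move=> t _; exact: g0E.
  by move=> j t t0; exact: is_derive_kval.
move=> f g h.
(* The function outside the integral is [g] at [u = 0]. *)
have [fex fE] : deriv_lim_exists k f 1 /\ deriv_lim k f 1 = kval (s k) 0 1.
  by apply: ch => // t; rewrite -gE addr0.
have gch u : 1 < u ->
    deriv_lim_exists k (g u) 1 /\ deriv_lim k (g u) 1 = kval (s k) u 1.
  by move=> u1; apply: ch => [|t]; [rewrite ltW// (lt_trans _ u1)|exact: gE].
have hE u : 1 < u -> h u = weight u * kval (s k) u 1.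
  by move=> u1; rewrite /h (gch u u1).2 mul1r.
split.
- exact: fex.
- by move=> u /gch[].
- apply: (eq_integrable _ _ _ _ (integrable_kval (s k) ltr01)) => //.
  by move=> u; rewrite inE/= in_itv/= andbT => u1; rewrite hE.
(* The [k]-th derivative of [A_m] at [1] is taken once from the coefficients and once from the
   integral form. *)
rewrite -apoly_derivn1// apoly_derivn// fE /kint; congr (_ * (_ + _)).
by apply: eq_Rintegral => u; rewrite inE/= in_itv/= andbT => u1; rewrite hE.
Qed.
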